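(* The following decision problem $\mathrm{CompletelyRegular}$ is in $\mathsf{NL}$. Input: transformations $a_1,\dots,a_k\in T_n$. Problem: is $\langle a_1,\dots,a_k\rangle$ completely regular?
   Context: $T_n$ is the full transformation semigroup on $[n]=\{1,\dots,n\}$: all maps $[n]\to[n]$, acting on the right, under composition. $\langle a_1,\dots,a_k\rangle$ is the subsemigroup of $T_n$ generated by $a_1,\dots,a_k$ ($k,n\ge 1$). In the input each transformation is given by its table of values, and $k,n$ are part of the input. A semigroup $S$ is completely regular if every element of $S$ belongs to some subgroup of $S$ (a subsemigroup of $S$ that is a group). $\mathsf{NL}$ is the class of sets decidable in nondeterministic logarithmic space. *)

(* Defs.v *)
From HB Require Import structures.
From Stdlib Require Export Relation_Operators.
From mathcomp Require Export all_boot.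
From mathcomp Require Import monoid.

Set Implicit Arguments.
Unset Strict Implicit.
Unset Printing Implicit Defensive.

(** * Nondeterministic logarithmic space *)

Inductive move := MoveL | Stay | MoveR.

Inductive scanned (A : Type) := LeftEnd | RightEnd | Letter of A.
Arguments LeftEnd {A}.
Arguments RightEnd {A}.

Record action (Q G : Type) (k : nat) := Action {
  next_state : Q;
  input_move : move;
  work_write : {ffun 'I_k -> G};
  work_move : {ffun 'I_k -> move} }.

(* A nondeterministic Turing machine with a read-only two-way input tape,
   delimited by end markers, and [ntapes] read-write work tapes that are
   infinite to the right.  All the actions allowed by [trans] are possible
   moves; if there is none, the machine halts. *)
Record ntm (A : finType) := NTM {
  state : finType;
  symbol : finType;
  ntapes : nat;
  blank : symbol;
  start : state;
  accepting : pred state;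
  trans : state -> scanned A -> {ffun 'I_ntapes -> symbol} ->
          pred (action state symbol ntapes) }.

Section Computations.
Variables (A : finType) (M : ntm A) (w : seq A).

(* Input positions are 0 (left end marker), 1, ..., size w (the letters) and
   (size w).+1 (right end marker). *)
Record config := Config {
  cstate : state M;
  input_head : nat;
  tape : 'I_(ntapes M) -> nat -> symbol M;
  work_head : 'I_(ntapes M) -> nat }.

Definition initial : config :=
  Config (start M) 0 (fun _ _ => blank M) (fun _ => 0).

Definition scan (h : nat) : scanned A :=
  if h is p.+1 then nth RightEnd (map (@Letter A) w) p else LeftEnd.

(* A left move on the leftmost cell leaves the head in place. *)
Definition shift (m : move) (h : nat) : nat :=
  match m with MoveL => h.-1 | Stay => h | MoveR => h.+1 end.

Definition perform (c : config) (a : action (state M) (symbol M) (ntapes M)) :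
    config :=
  Config (next_state a)
         (minn (shift (input_move a) (input_head c)) (size w).+1)
         (fun i p => if p == work_head c i then work_write a i else tape c i p)
         (fun i => shift (work_move a i) (work_head c i)).

Definition step (c c' : config) : Prop :=
  exists2 a, trans (cstate c) (scan (input_head c))
                   [ffun i => tape c i (work_head c i)] a
           & c' = perform c a.

Definition reachable (c : config) : Prop := clos_refl_trans config step initial c.

Definition halted (c : config) : Prop := forall c', ~ step c c'.

Definition accepts : Prop :=
  exists c, [/\ reachable c, halted c & accepting (cstate c)].

(* There is no infinite computation. *)
Definition always_halts : Prop := Acc (fun c' c => step c c') initial.

(* The cells visited on a work tape form an initial segment, so this says that
   no computation visits more than [s] cells on any of the work tapes. *)
Definition runs_in_space (s : nat) : Prop :=
  forall c, reachable c -> forall i, work_head c i < s.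

End Computations.

(* The bound [C * (log_2 |w| + 1)] expresses O(log |w|), with a sensible value
   on words of length 0 and 1. *)
Definition NL (A : finType) (L : seq A -> Prop) : Prop :=
  exists (M : ntm A) (C : nat), forall w : seq A,
    [/\ always_halts M w,
        runs_in_space M w (C * (trunc_log 2 (size w)).+1)
      & L w <-> accepts M w].

(** * Completely regular semigroups *)

Section Semigroups.
Variable T : semigroupType.
Implicit Types (A S G : T -> Prop) (x y e : T).
Local Open Scope group_scope.

Inductive generated A : T -> Prop :=
| gen_in x : A x -> generated A x
| gen_mul x y : generated A x -> generated A y -> generated A (x * y).

(* The identity element of [G] need not be an identity of [T]. *)
Definition is_subgroup G : Prop :=
  (forall x y, G x -> G y -> G (x * y)) /\
  exists e, [/\ G e,
    forall x, G x -> e * x = x /\ x * e = x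
  & forall x, G x -> exists y, [/\ G y, x * y = e & y * x = e]].

Definition subgroup_of G S : Prop := (forall x, G x -> S x) /\ is_subgroup G.

Definition completely_regular S : Prop :=
  forall x, S x -> exists2 G, subgroup_of G S & G x.

End Semigroups.

(** * Transformations *)

Definition transformation (n : nat) : Type := {ffun 'I_n -> 'I_n}.
HB.instance Definition _ n := Finite.on (transformation n).

(* Transformations act on the right: [x (a b) = (x a) b]. *)
Definition trans_mul n (a b : transformation n) : transformation n :=
  [ffun x => b (a x)].

Lemma trans_mulA n : associative (@trans_mul n).
Proof. by move=> a b c; apply/ffunP=> x; rewrite !ffunE. Qed.

HB.instance Definition _ n := hasMul.Build (transformation n) (@trans_mul n).
HB.instance Definition _ n :=
  Magma_isSemigroup.Build (transformation n) (@trans_mulA n).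

(** * The decision problem *)

Inductive letter := Bit of bool | Comma | Semicolon.

Definition letter_code (l : letter) : option (option bool) :=
  match l with Bit b => Some (Some b) | Comma => Some None | Semicolon => None end.
Definition letter_decode (o : option (option bool)) : letter :=
  match o with Some (Some b) => Bit b | Some None => Comma | None => Semicolon end.
Lemma letter_codeK : cancel letter_code letter_decode.
Proof. by case. Qed.

HB.instance Definition _ := Countable.copy letter (can_type letter_codeK).
HB.instance Definition _ : isFinite letter := CanIsFinite letter_codeK.

(* Binary digits, least significant first, without leading zeros:
   [up_log 2 m.+1] is the bit length of [m]. *)
Definition binary (m : nat) : seq bool :=
  mkseq (fun j => odd (m %/ 2 ^ j)) (up_log 2 m.+1).

(* The element [i : 'I_n] stands for the point [i.+1] of {1, ..., n}. *)
Definition encode_point n (i : 'I_n) : seq letter :=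
  rcons (map Bit (binary i.+1)) Comma.

Definition encode_transformation n (a : transformation n) : seq letter :=
  rcons (flatten [seq encode_point (a i) | i <- enum 'I_n]) Semicolon.

(* The numbers [k] of tables and [n] of entries per table can be read off from
   the separators. *)
Definition encode k n (a : k.-tuple (transformation n)) : seq letter :=
  flatten [seq encode_transformation b | b <- a].

(* Words that do not encode an instance are not in the language. *)
Definition CompletelyRegular (w : seq letter) : Prop :=
  exists (k n : nat) (a : k.-tuple (transformation n)),
    [/\ 0 < k, 0 < n, w = encode a
      & completely_regular (generated (fun b => b \in a))].

(* Main.v *)
From HB Require Import structures.
Require Import Defs.
From mathcomp Require Import zify monoid.
From Stdlib Require Import Operators_Properties.

Set Implicit Arguments.
Unset Strict Implicit.
Unset Printing Implicit Defensive.

(* A semigroup of transformations is completely regular iff each of its elements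
   is injective on its own image.  It is not iff some word maps a quadruple
   (p, q, r, s) with r <> s to a quadruple (r, s, t, t).  So complete regularity
   is a non-reachability property of a graph with n^4 vertices, and it is decided
   by the inductive counting of Immerman and Szelepcsenyi: from the number of
   vertices at distance at most d from the start one gets the number for d + 1,
   because a nondeterministic enumeration of the former set, with a path guessed
   for every member, can be certified complete by counting its members.

   The numbers involved are polynomial in the input length.  They are kept as
   registers of programs whose loops run at most |w| + 1 times, so that such
   programs halt and use logarithmic space for syntactic reasons.  Soundness
   needs all runs and completeness needs one run; a boolean selects the
   quantifier, so that deterministic parts are verified only once. *)

(** A word cannot be stored in logarithmic space, so its action must be followed on all relevant
    points at once. If [x] is not injective on its image, then [p x = r], [q x = s] and
    [r x = s x = t] for some points with [r <> s]; four points are thus a complete witness, and the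
    start (p, q, r, s) is known before any letter is guessed.

    The commands copy, increment and compare registers, with no further arithmetic. A number in the
    input is therefore not decoded: it is guessed and then matched digit by digit. A single loop is
    too short to count to n^4, which is why the long counts are made by four nested loops; these
    enumerate the vertices as well.

    Halting and the space bound are required of every run, also of those that guess wrongly. A wrong
    guess ends in a dead end, a halting state that does not accept; the bound on the register
    contents must hold on such runs too, and is therefore derived from the shape of the program and
    not from what it computes. *)

Definition move_code (m : move) : option bool :=
  match m with MoveL => None | Stay => Some false | MoveR => Some true end.
Definition move_decode (o : option bool) : move :=
  match o with None => MoveL | Some false => Stay | Some true => MoveR end.
Lemma move_codeK : cancel move_code move_decode. Proof. by case. Qed.
HB.instance Definition _ := Equality.copy move (can_type move_codeK).

(** * Control fragments on a single work tape *)

Section Fragments.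
Variable N : nat.

Definition col : finType := {ffun 'I_N.+1 -> bool}.
Definition sym : finType := option (option col).

(** A left move on cell 0 leaves the head in place unnoticed; this symbol makes the left end
    recognizable. *)
Definition mark : sym := Some None.
Definition cell (c : col) : sym := Some (Some c).

Definition instr : eqType := (move * sym * move)%type.

(** A move leads to a control state ([inl]) or leaves the fragment with a result bit ([inr]), so
    that fragments can be composed like conditionals. An empty list of moves is a dead end. *)
Record frag := Frag {
  ctl : finType;
  entry : ctl;
  tr : ctl -> scanned letter -> sym -> seq ((ctl + bool) * instr) }.

Record mem := Mem { hd : nat; tp : nat -> sym; wp : nat }.

Variable w : seq letter.
Variable space : nat.

Definition perf (a : instr) (m : mem) : mem :=
  Mem (minn (shift a.1.1 (hd m)) (size w).+1)
      (fun p => if p == wp m then a.1.2 else tp m p)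
      (shift a.2 (wp m)).

Definition outs F (q : ctl F) (m : mem) := tr q (scan w (hd m)) (tp m (wp m)).

(* For [b = true] every run from the given point stops, stays within the space
   bound and exits in [Q]; for [b = false] some run does. *)
Inductive MW (b : bool) F (Q : bool -> mem -> Prop) : ctl F + bool -> mem -> Prop :=
| MW_exit r m : wp m < space -> Q r m -> MW b Q (inr r) m
| MW_all q m : b -> wp m < space ->
    (forall (x : ctl F + bool) (a : instr), (x, a) \in outs q m -> MW b Q x (perf a m)) -> MW b Q (inl q) m
| MW_some q m (x : ctl F + bool) (a : instr) : ~~ b -> wp m < space ->
    (x, a) \in outs q m -> MW b Q x (perf a m) -> MW b Q (inl q) m.

Lemma MW_mono b F (Q Q' : bool -> mem -> Prop) (x : ctl F + bool) m :
  (forall r m', Q r m' -> Q' r m') -> MW b Q x m -> MW b Q' x m.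
Proof.
move=> QQ'; elim=> {x m}.
- by move=> r m sp q; apply: MW_exit => //; exact: QQ'.
- by move=> q m hb sp _ IH; apply: MW_all.
- by move=> q m x a hb sp xa _; apply: MW_some xa.
Qed.

Lemma MW_det b F Q (q : ctl F) m x a :
  outs q m = [:: (x, a)] -> wp m < space -> MW b Q x (perf a m) ->
  MW b Q (inl q) m.
Proof.
move=> out sp; case: b => mw.
  by apply: MW_all => // x' a'; rewrite out mem_seq1 => /eqP[-> ->].
by apply: (MW_some (x := x) (a := a)) => //; rewrite out mem_seq1.
Qed.

Definition lift_outs (T U : eqType) (f : T -> U) (s : seq (T * instr)) :=
  [seq (f o.1, o.2) | o <- s].

(** The combinators below only rename control states and redirect exits, so this one simulation
    serves conditionals and loops alike. *)
Lemma MW_lift b F G (f : ctl F + bool -> ctl G + bool) Q Q' x m :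
  (forall q, exists2 q', f (inl q) = inl q' &
     forall sc sy, tr q' sc sy = lift_outs f (tr q sc sy)) ->
  (forall r m', wp m' < space -> Q r m' -> MW b Q' (f (inr r)) m') ->
  MW b Q x m -> MW b Q' (f x) m.
Proof.
move=> fq fr; elim=> {x m}.
- by move=> r m sp; exact: fr.
- move=> q m hb sp _ IH; have [q' -> trq] := fq q.
  apply: MW_all => // x a; rewrite /outs trq => /mapP[[x' a'] /= /IH mw [-> ->]].
  exact: mw.
- move=> q m x a hb sp xa _ mw; have [q' -> trq] := fq q.
  apply: (MW_some (x := f x) (a := a)) => //; rewrite /outs trq.
  by apply/mapP; exists (x, a).
Qed.

Section Ite.
Variables F G H : frag.
Definition ite_ctl : finType := (ctl F + (ctl G + ctl H))%type.
Definition ite_then (x : ctl G + bool) : ite_ctl + bool :=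
  match x with inl q => inl (inr (inl q)) | inr r => inr r end.
Definition ite_else (x : ctl H + bool) : ite_ctl + bool :=
  match x with inl q => inl (inr (inr q)) | inr r => inr r end.
Definition ite_if (x : ctl F + bool) : ite_ctl + bool :=
  match x with
  | inl q => inl (inl q)
  | inr true => inl (inr (inl (entry G)))
  | inr false => inl (inr (inr (entry H)))
  end.
Definition ite_tr (q : ite_ctl) sc sy : seq ((ite_ctl + bool) * instr) :=
  match q with
  | inl q => lift_outs ite_if (tr q sc sy)
  | inr (inl q) => lift_outs ite_then (tr q sc sy)
  | inr (inr q) => lift_outs ite_else (tr q sc sy)
  end.
Definition ite := Frag (inl (entry F)) ite_tr.

Lemma MW_ite b Q m :
  MW b (fun r m' => if r then MW b Q (inl (entry G)) m'
                    else MW b Q (inl (entry H)) m') (inl (entry F)) m ->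
  MW b Q (inl (entry ite)) m.
Proof.
apply: (@MW_lift _ F ite ite_if) => [q|]; first by exists (inl q).
move=> [] m' sp mw.
  by apply: (@MW_lift _ G ite ite_then) mw => [q|r m'' sp']; [exists (inr (inl q))|exact: MW_exit].
by apply: (@MW_lift _ H ite ite_else) mw => [q|r m'' sp']; [exists (inr (inr q))|exact: MW_exit].
Qed.
End Ite.

Definition seqf F G := ite F G G.

Lemma MW_seq b F G Q m :
  MW b (fun _ m' => MW b Q (inl (entry G)) m') (inl (entry F)) m ->
  MW b Q (inl (entry (seqf F G))) m.
Proof. by move=> mw; apply: MW_ite; apply: MW_mono mw => -[]. Qed.

Definition loop_if F (x : ctl F + bool) : ctl F + bool :=
  match x with inl q => inl q | inr true => inl (entry F) | inr false => inr true end.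
Definition loop F := Frag (entry F) (fun q sc sy => lift_outs (@loop_if F) (tr q sc sy)).

(** A single unfolding. Since [MW] is inductive and thereby excludes infinite runs, termination is
    left to an induction at each use. *)
Lemma MW_loop b F Q m :
  MW b (fun r m' => if r then MW b Q (inl (entry (loop F))) m' else Q true m')
     (inl (entry F)) m ->
  MW b Q (inl (entry (loop F))) m.
Proof.
apply: (@MW_lift _ F (loop F) (@loop_if F)) => [q|]; first by exists q.
by move=> [] m' sp mw //=; exact: MW_exit.
Qed.

Definition prim (f : scanned letter -> sym -> seq (bool * instr)) :=
  @Frag unit tt (fun _ sc sy => lift_outs inr (f sc sy)).

Lemma MW_prim b f r a Q m :
  f (scan w (hd m)) (tp m (wp m)) = [:: (r, a)] -> wp m < space ->
  wp (perf a m) < space -> Q r (perf a m) -> MW b Q (inl (entry (prim f))) m.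
Proof.
move=> fE sp sp' q; apply: (@MW_det _ _ _ _ _ (inr r) a) => //.
  by rewrite /outs /= fE.
exact: MW_exit.
Qed.

Definition idle (sy : sym) : instr := (Stay, sy, Stay).
Definition ret r := prim (fun _ sy => [:: (r, idle sy)]).
Definition fail := prim (fun _ _ => [::]).
Definition flip := prim (fun _ sy => [:: (true, idle sy); (false, idle sy)]).

(* One pass over the work tape by a finite transducer, which may also advance the
   input head, extend the tape by one column and compute a bit; the work head
   then returns to the left end. *)
Definition seq_of_opt (T : Type) (o : option T) : seq T :=
  if o is Some x then [:: x] else [::].

Section Sweep.
Variables (S : finType) (s0 : S).
Variable delta : S -> scanned letter -> col -> S * col * bool.
Variable ext : S -> option col.
Variable res : S -> scanned letter -> bool.

Definition sweep_tr (q : S + bool) sc (sy : sym) : seq (((S + bool) + bool) * instr) :=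
  match q with
  | inl q =>
    match sy with
    | Some (Some c) =>
      let: (q', c', mv) := delta q sc c in
      [:: (inl (inl q'), (if mv then MoveR else Stay, cell c', MoveR))]
    | Some None => [:: (inl (inl q), (Stay, sy, MoveR))]
    | None => [:: (inl (inr (res q sc)), (Stay, omap some (ext q), MoveL))]
    end
  | inr r =>
    if sy == mark then [:: (inr r, idle sy)] else [:: (inl (inr r), (Stay, sy, MoveL))]
  end.
Definition sweep := @Frag (S + bool)%type (inl s0) sweep_tr.

(** The forward pass as a function on columns: last state, last input position, rewritten columns.
    The correctness of an operation becomes an induction on a list, free of configurations. *)
Fixpoint trd q h (cs : seq col) : S * nat * seq col :=
  if cs is c :: cs then
    let: (q1, c1, mv) := delta q (scan w h) c in
    let h1 := if mv then minn h.+1 (size w).+1 else h in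
    let: (q2, h2, cs2) := trd q1 h1 cs in (q2, h2, c1 :: cs2)
  else (q, h, [::]).

Definition tape_is (t : nat -> sym) (cs : seq col) : Prop :=
  t =1 nth None (mark :: map cell cs).

Lemma tape_is_write (T : Type) (d : T) t pre x y post (f : nat -> T) :
  f =1 nth d (pre ++ x :: post) -> t = size pre ->
  (fun p => if p == t then y else f p) =1 nth d (pre ++ y :: post).
Proof.
move=> fE -> p; rewrite fE !nth_cat; case: ltngtP => //= [lt|->].
  by rewrite -(subnSK lt).
by rewrite subnn.
Qed.

Lemma sweep_back b cs Q r m :
  tape_is (tp m) cs -> wp m <= size cs -> (size cs).+1 < space ->
  hd m <= (size w).+1 ->
  (forall m', tape_is (tp m') cs -> hd m' = hd m -> wp m' = 0 -> Q r m') ->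
  MW b Q (inl (inr r) : ctl sweep + bool) m.
Proof.
move: {2}(wp m) (erefl (wp m)) => i; elim: i m => [|i IH] m pi tm le sp hm Qm.
  have t0 : tp m (wp m) = mark by rewrite pi tm.
  apply: (@MW_det b sweep Q (inr r) m (inr r) (idle mark)).
  - by rewrite /outs /= t0 eqxx.
  - lia.
  apply: MW_exit; first by rewrite /=; lia.
  apply: Qm => /=; [|by apply/minn_idPl|by []].
  by move=> p; case: eqP => [->|_]; rewrite ?tm ?pi.
have ti : tp m (wp m) = cell (nth [ffun=> false] cs i).
  by rewrite pi tm /= (nth_map [ffun=> false]) // -pi.
apply: (@MW_det b sweep Q (inr r) m (inl (inr r)) (Stay, tp m (wp m), MoveL)).
- by rewrite /outs /= ti.
- lia.
have hE : minn (hd m) (size w).+1 = hd m by apply/minn_idPl.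
apply: IH => //=.
- by rewrite pi.
- by move=> p; case: eqP => [->|_]; rewrite tm.
- by rewrite pi /=; rewrite pi in le; exact: ltnW.
- by rewrite hE.
- by rewrite hE.
Qed.

Lemma sweep_forth b rem pre Q q m :
  tape_is (tp m) (pre ++ rem) -> wp m = (size pre).+1 ->
  (size (pre ++ rem)).+2 < space -> hd m <= (size w).+1 ->
  let o := trd q (hd m) rem in
  (forall m', tape_is (tp m') (pre ++ o.2 ++ seq_of_opt (ext o.1.1)) ->
     hd m' = o.1.2 -> wp m' = 0 -> Q (res o.1.1 (scan w o.1.2)) m') ->
  MW b Q (inl (inl q) : ctl sweep + bool) m.
Proof.
elim: rem pre q m => [|c rem IH] pre q m tm pi sp hm /=.
  rewrite cats0 in tm sp; move=> Qm.
  have t0 : tp m (wp m) = None.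
    by rewrite pi tm /= nth_default // size_map.
  have hE : minn (hd m) (size w).+1 = hd m by apply/minn_idPl.
  set r := res q (scan w (hd m)) in Qm.
  apply: (@MW_det b sweep Q (inl q) m (inl (inr r)) (Stay, omap some (ext q), MoveL)).
  - by rewrite /outs /= t0.
  - lia.
  apply: (@sweep_back b (pre ++ seq_of_opt (ext q))) => /=.
  (* Appending the default value makes the blank cell under the head an explicit entry, so that
     writing on it is a list update. *)
  - have tm' : tp m =1 nth None ((mark :: map cell pre) ++ [:: None]).
      move=> p; rewrite tm nth_cat; case: ltnP => // le.
      by rewrite nth_default //; case: (p - _) => [|[]].
    move=> p; rewrite (tape_is_write _ tm') ?pi /= ?size_map //.
    case: (ext q) => [c|] /=; first by rewrite map_cat.
    by rewrite cats0 -tm' tm.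
  - by rewrite pi size_cat /=; lia.
  - by move: sp; rewrite size_cat; case: (ext q) => [c|] /=; lia.
  - lia.
  - by move=> m' tm' hm' pm'; apply: Qm => //; rewrite hm' hE.
move=> Qm.
have t0 : tp m (wp m) = cell c.
  by rewrite pi tm /= map_cat nth_cat size_map ltnn subnn.
case E: (delta q (scan w (hd m)) c) Qm => [[q' c'] mv].
case E2: trd => [[q2 h2] cs2] /= Qm.
apply: (@MW_det b sweep Q (inl q) m (inl (inl q')) (if mv then MoveR else Stay, cell c', MoveR)).
- by rewrite /outs /= t0 /= E.
- by move: sp; rewrite size_cat; lia.
have hE : minn (shift (if mv then MoveR else Stay) (hd m)) (size w).+1
        = if mv then minn (hd m).+1 (size w).+1 else hd m.
  by case: mv {E Qm E2} => //=; apply/minn_idPl.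
apply: (IH (rcons pre c')) => /=.
- have tm' : tp m =1 nth None ((mark :: map cell pre) ++ cell c :: map cell rem).
    by move=> p; rewrite tm map_cat.
  move=> p; rewrite (tape_is_write _ tm') ?pi /= ?size_map //.
  by rewrite cat_rcons map_cat.
- by rewrite size_rcons pi.
- by move: sp; rewrite !size_cat size_rcons /=; lia.
- lia.
rewrite hE E2 /= => m' tm' hm' pm'; apply: Qm => //.
by rewrite -cat_rcons.
Qed.

Lemma MW_sweep b cs Q m :
  tape_is (tp m) cs -> wp m = 0 -> (size cs).+2 < space -> hd m <= (size w).+1 ->
  let o := trd s0 (hd m) cs in
  (forall m', tape_is (tp m') (o.2 ++ seq_of_opt (ext o.1.1)) ->
     hd m' = o.1.2 -> wp m' = 0 -> Q (res o.1.1 (scan w o.1.2)) m') ->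
  MW b Q (inl (entry sweep)) m.
Proof.
move=> tm pm sp hm o Qm.
have t0 : tp m (wp m) = mark by rewrite pm tm.
have hE : minn (hd m) (size w).+1 = hd m by apply/minn_idPl.
apply: (@MW_det b sweep Q _ m (inl (inl s0)) (Stay, mark, MoveR)).
- by rewrite /outs /= t0.
- lia.
apply: (@sweep_forth b cs [::]) => /=; rewrite ?pm ?hE //.
by move=> [|p] /=; rewrite ?tm.
Qed.

End Sweep.

End Fragments.

Arguments ret N r : clear implicits.
Arguments fail N : clear implicits.
Arguments flip N : clear implicits.

(** * Register programs *)

Definition store := nat -> nat.
Definition upd (s : store) r v : store := fun x => if x == r then v else s x.

(* Register [HD] is the input head; [LEN] permanently holds the length of the
   input plus one, and [ZR] holds zero. *)
Definition HD := 0.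
Definition LEN := 1.
Definition ZR := 2.

(** [MatchA r] moves over the digits of a number in the input if that number equals register [r],
    and is a dead end otherwise; combined with guessing, it is how numbers of the input reach the
    registers. *)
Inductive cmd :=
| Skip
| Fail
| Inc of nat
| Copy of nat & nat
| HReset
| HRight
| MatchA of nat
| Seq of cmd & cmd
| Choice of cmd & cmd
| IfEq of nat & nat & cmd & cmd
| IfScan of (scanned letter -> bool) & cmd & cmd
| For of nat & nat & cmd.

Fixpoint writes (c : cmd) : seq nat :=
  match c with
  | Skip | Fail => [::]
  | Inc r | Copy r _ => [:: r]
  | HReset | HRight | MatchA _ => [:: HD]
  | Seq c1 c2 | Choice c1 c2 | IfEq _ _ c1 c2 | IfScan _ c1 c2 => writes c1 ++ writes c2
  | For r _ c => r :: writes c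
  end.

Definition bval (bs : seq bool) : nat := foldr (fun (b : bool) n => b + n.*2) 0 bs.

(** * Weakest preconditions *)

Section Semantics.
Variable w : seq letter.

(* Digits come least significant first: [last false ds] excludes leading zeros,
   and the empty block. *)
Definition block_at h v ds :=
  [/\ 0 < h, exists tl, drop h.-1 w = map Bit ds ++ Comma :: tl,
      last false ds & bval ds = v].

(* The weakest precondition, for all runs if [b] holds and for some run otherwise. *)
Fixpoint W (b : bool) (c : cmd) (Q : store -> Prop) (s : store) : Prop :=
  match c with
  | Skip => Q s
  | Fail => b
  | Inc r => Q (upd s r (s r).+1)
  | Copy r r' => Q (upd s r (s r'))
  | HReset => Q (upd s HD 0)
  | HRight => Q (upd s HD (minn (s HD).+1 (size w).+1))
  | MatchA r =>
    if b then forall ds, block_at (s HD) (s r) ds -> Q (upd s HD (s HD + size ds))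
    else exists2 ds, block_at (s HD) (s r) ds & Q (upd s HD (s HD + size ds))
  | Seq c1 c2 => W b c1 (W b c2 Q) s
  | Choice c1 c2 => if b then W b c1 Q s /\ W b c2 Q s else W b c1 Q s \/ W b c2 Q s
  | IfEq r r' c1 c2 => if s r == s r' then W b c1 Q s else W b c2 Q s
  | IfScan p c1 c2 => if p (scan w (s HD)) then W b c1 Q s else W b c2 Q s
  | For r rb c =>
    iter (minn (s rb) (size w).+1)
      (fun Q' => W b c (fun s1 => Q' (upd s1 r (s1 r).+1))) Q (upd s r 0)
  end.

Lemma iter_mono T (F : (T -> Prop) -> T -> Prop) k (Q Q' : T -> Prop) s :
  (forall P P' t, (forall t', P t' -> P' t') -> F P t -> F P' t) ->
  (forall t, Q t -> Q' t) -> iter k F Q s -> iter k F Q' s.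
Proof.
move=> mF QQ'; elim: k s => [|k IH] s /=; first exact: QQ'.
exact: mF.
Qed.

Lemma W_mono b c (Q Q' : store -> Prop) s :
  (forall s', Q s' -> Q' s') -> W b c Q s -> W b c Q' s.
Proof.
elim: c Q Q' s => //=.
- by move=> Q Q' s QQ'; apply: QQ'.
- by move=> r Q Q' s QQ'; apply: QQ'.
- by move=> r r' Q Q' s QQ'; apply: QQ'.
- by move=> Q Q' s QQ'; apply: QQ'.
- by move=> Q Q' s QQ'; apply: QQ'.
- move=> r Q Q' s QQ'; case: b => [H ds /H|[ds m /QQ']]; first exact: QQ'.
  by exists ds.
- by move=> c1 IH1 c2 IH2 Q Q' s QQ'; apply: IH1 => s'; apply: IH2.
- move=> c1 IH1 c2 IH2 Q Q' s QQ'; case: b IH1 IH2 => IH1 IH2.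
    by case=> h1 h2; split; [apply: IH1 h1|apply: IH2 h2].
  by case=> h; [left; apply: IH1 h|right; apply: IH2 h].
- by move=> r r' c1 IH1 c2 IH2 Q Q' s QQ'; case: ifP => _; [apply: IH1|apply: IH2].
- by move=> p c1 IH1 c2 IH2 Q Q' s QQ'; case: ifP => _; [apply: IH1|apply: IH2].
- move=> r rb c IH Q Q' s QQ'; apply: iter_mono => // P P' t PP'.
  by apply: IH => s'; exact: PP'.
Qed.

Definition same_off (l : seq nat) (s s' : store) := forall r, r \notin l -> s' r = s r.

(** The frame rule: specifications need to mention only the registers that change, and all other
    facts are carried along through [writes]. *)
Lemma W_frame b c (Q : store -> Prop) s :
  W b c Q s -> W b c (fun s' => Q s' /\ same_off (writes c) s s') s.
Proof.
elim: c Q s => //=.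
- by move=> r Q s Qs; split=> // x; rewrite inE /upd => /negPf->.
- by move=> r r' Q s Qs; split=> // x; rewrite inE /upd => /negPf->.
- by move=> Q s Qs; split=> // x; rewrite inE /upd => /negPf->.
- by move=> Q s Qs; split=> // x; rewrite inE /upd => /negPf->.
- move=> r Q s; case: b => [H ds /H|[ds m]] h.
    by split=> // x; rewrite inE /upd => /negPf->.
  by exists ds => //; split=> // x; rewrite inE /upd => /negPf->.
- move=> c1 IH1 c2 IH2 Q s /IH1; apply: W_mono => s1 [/IH2 h f1].
  apply: W_mono h => s2 [q f2]; split=> // r; rewrite mem_cat negb_or => /andP[r1 r2].
  by rewrite f2 ?f1.
- move=> c1 IH1 c2 IH2 Q s.
  have f1 : W b c1 Q s ->
      W b c1 (fun s' => Q s' /\ same_off (writes c1 ++ writes c2) s s') s.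
    move/IH1; apply: W_mono => s' [q f]; split=> // r.
    by rewrite mem_cat negb_or => /andP[r1 r2]; apply: f.
  have f2 : W b c2 Q s ->
      W b c2 (fun s' => Q s' /\ same_off (writes c1 ++ writes c2) s s') s.
    move/IH2; apply: W_mono => s' [q f]; split=> // r.
    by rewrite mem_cat negb_or => /andP[r1 r2]; apply: f.
  case: b f1 f2 {IH1 IH2} => f1 f2; first by case=> /f1 ? /f2 ?; split.
  by case=> [/f1|/f2] ?; [left|right].
- move=> r r' c1 IH1 c2 IH2 Q s; case: ifP => _ => [/IH1|/IH2]; apply: W_mono => s' [q f].
    by split=> // x; rewrite mem_cat negb_or => /andP[x1 x2]; apply: f.
  by split=> // x; rewrite mem_cat negb_or => /andP[x1 x2]; apply: f.
- move=> p c1 IH1 c2 IH2 Q s; case: ifP => _ => [/IH1|/IH2]; apply: W_mono => s' [q f].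
    by split=> // x; rewrite mem_cat negb_or => /andP[x1 x2]; apply: f.
  by split=> // x; rewrite mem_cat negb_or => /andP[x1 x2]; apply: f.
- move=> r rb c IH Q s; set F := fun _ => _.
  have gen k s0 : iter k F Q s0 ->
      iter k F (fun s' => Q s' /\ same_off (r :: writes c) s0 s') s0.
    elim: k s0 => [|k IHk] s0 //= /IH; apply: W_mono => s1 [/IHk h f].
    apply: iter_mono h => [P P' t PP'|t [q f']].
      by apply: W_mono => s'; exact: PP'.
    split=> // x xr; rewrite f' // /upd.
    by move: xr; rewrite inE negb_or => /andP[/negPf-> /f].
  move/gen; apply: iter_mono => [P P' t PP'|t [q f']].
    by apply: W_mono => s'; exact: PP'.
  split=> // x xr; rewrite f' // /upd.
  by move: xr; rewrite inE negb_or => /andP[/negPf-> _].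
Qed.

Lemma W_spec b c (P Q : store -> Prop) s :
  W b c P s -> (forall s', P s' -> same_off (writes c) s s' -> Q s') -> W b c Q s.
Proof. by move=> /W_frame h PQ; apply: W_mono h => s' [p f]; exact: PQ. Qed.

(** Under [s rb <= (size w).+1] the built-in cap on the number of rounds is inactive, and what
    remains is an ordinary counting loop. The frame is taken relative to the store before the
    loop. *)
Lemma W_for b r rb c (I : nat -> store -> Prop) (Q : store -> Prop) s :
  r \notin rb :: writes c -> rb \notin writes c -> s rb <= (size w).+1 ->
  I 0 (upd s r 0) ->
  (forall i s0, i < s rb -> s0 r = i -> same_off (r :: writes c) s s0 -> I i s0 ->
     W b c (fun s1 => I i.+1 (upd s1 r i.+1)) s0) ->
  (forall s', s' r = s rb -> same_off (r :: writes c) s s' -> I (s rb) s' -> Q s') ->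
  W b (For r rb c) Q s.
Proof.
rewrite inE negb_or => /andP[rrb rc] rbc le I0 IS IQ /=.
rewrite (minn_idPl le); set F := fun _ => _.
have gen k i s0 : i + k = s rb -> s0 r = i -> same_off (r :: writes c) s s0 ->
    I i s0 -> iter k F Q s0.
  elim: k i s0 => [|k IH] i s0 /= ik s0r fr Ii.
    by rewrite addn0 in ik; apply: IQ => //; [rewrite s0r|rewrite -ik].
  have lt : i < s rb by lia.
  apply: W_spec (IS i s0 lt s0r fr Ii) _ => s1 Is1 fr1.
  have s1r : s1 r = i by rewrite fr1.
  rewrite s1r; apply: (IH i.+1) => //; first by lia.
    by rewrite /upd eqxx.
  move=> x xr; rewrite /upd; have /andP[/negPf-> xc] : (x != r) && (x \notin writes c).
    by rewrite -negb_or -in_cons.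
  by rewrite fr1 // fr.
apply: (gen _ 0) => //; first by rewrite /upd eqxx.
by move=> x; rewrite inE negb_or /upd => /andP[/negPf->].
Qed.

End Semantics.

(** * Compiling register programs *)

Lemma scan_letter (w : seq letter) h a tl : 0 < h -> drop h.-1 w = a :: tl ->
  [/\ scan w h = Letter a, h <= size w & drop h w = tl].
Proof.
case: h => // h _ /= dE.
have lt : h < size w by case: ltnP => // le; rewrite drop_oversize in dE.
have E := drop_nth a lt; rewrite dE in E; case: E => aE tlE.
by split=> //; rewrite (nth_map a) // -aE.
Qed.

Lemma scanned_letter (w : seq letter) h a : scan w h = Letter a -> 0 < h /\ drop h.-1 w = a :: drop h w.
Proof.
case: h => [|h] //=; case: (ltnP h (size w)) => [lt|le]; last first.
  by rewrite nth_default // size_map.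
by rewrite (nth_map a) // => -[aE]; rewrite (drop_nth a) // aE.
Qed.

Section Compile.
Variable N : nat.
Notation col := (col N).
Notation frag := (frag N).

(* All registers share one tape: the column at position [j.+1] holds the digits of
   weight [2 ^ j] of all of them. *)
Definition get (r : nat) (c : col) : bool := c (inord r).
Definition put (r : nat) (x : bool) (c : col) : col :=
  [ffun i => if val i == r then x else c i].
Definition vl (r : nat) (cs : seq col) := bval (map (get r) cs).

Lemma get_put r r' x c : r <= N -> r' <= N ->
  get r (put r' x c) = if r == r' then x else get r c.
Proof. by move=> rN r'N; rewrite /get ffunE /= inordK. Qed.

(** Ripple-carry increment: the state is the carry, and a carry that survives the last column
    becomes a new column in which only [r] has digit 1. *)
Definition incf r : frag :=
  sweep true (fun (q : bool) _ c => (q && get r c, put r (q (+) get r c) c, false))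
    (fun q => if q then Some [ffun i : 'I_N.+1 => val i == r] else None) (fun _ _ => true).
Definition copyf r r' : frag :=
  sweep tt (fun _ _ c => (tt, put r (get r' c) c, false)) (fun _ => None) (fun _ _ => true).
Definition eqf r r' : frag :=
  sweep true (fun q _ c => (q && (get r c == get r' c), c, false)) (fun _ => None)
    (fun q _ => q).

(* The state consists of a flag (no mismatch so far) and the last digit read. *)
Definition matchf r : frag :=
  sweep (true, false)
    (fun q sc c =>
       match sc with
       | Letter (Bit x) => ((q.1 && (x == get r c), x), c, true)
       | Letter Comma => ((q.1 && q.2 && ~~ get r c, q.2), c, false)
       | _ => ((false, false), c, false)
       end)
    (fun _ => None)
    (fun q sc => [&& q.1, q.2 & if sc is Letter Comma then true else false]).

Definition leftf : frag :=
  loop (prim (fun sc (sy : sym N) => if sc is LeftEnd then [:: (false, idle sy)]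
                             else [:: (true, (MoveL, sy, Stay))])).
Definition rightf : frag := prim (fun _ (sy : sym N) => [:: (true, (MoveR, sy, Stay))]).
Definition scanf p : frag := prim (fun sc (sy : sym N) => [:: (p sc, idle sy)]).

(** In a [For] loop the counter is compared with its bound and with [LEN]; the second test is the
    cap of the semantics. *)
Fixpoint comp (c : cmd) : frag :=
  match c with
  | Skip => ret N true
  | Fail => fail N
  | Inc r => incf r
  | Copy r r' => copyf r r'
  | HReset => leftf
  | HRight => rightf
  | MatchA r => ite (matchf r) (ret N true) (fail N)
  | Seq c1 c2 => seqf (comp c1) (comp c2)
  | Choice c1 c2 => ite (flip N) (comp c1) (comp c2)
  | IfEq r r' c1 c2 => ite (eqf r r') (comp c1) (comp c2)
  | IfScan p c1 c2 => ite (scanf p) (comp c1) (comp c2)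
  | For r rb c =>
    seqf (copyf r ZR)
      (loop (ite (eqf r rb) (ret N false)
               (ite (eqf r LEN) (ret N false) (seqf (comp c) (incf r)))))
  end.

(** Writable and readable registers: the head position is not on the tape, and the length and zero
    must never be overwritten. *)
Definition wreg r := 2 < r <= N.
Definition rreg r := 0 < r <= N.

Fixpoint wf (c : cmd) : bool :=
  match c with
  | Skip | Fail | HReset | HRight => true
  | Inc r => wreg r
  | Copy r r' => wreg r && rreg r'
  | MatchA r => rreg r
  | Seq c1 c2 | Choice c1 c2 | IfScan _ c1 c2 => wf c1 && wf c2
  | IfEq r r' c1 c2 => [&& rreg r, rreg r', wf c1 & wf c2]
  | For r rb c =>
    [&& wreg r, rreg rb, r \notin rb :: writes c, rb \notin writes c & wf c]
  end.

(* Loops run at most [L] times, whatever their bound register holds. *)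
Fixpoint growth (L : nat) (c : cmd) : nat :=
  match c with
  | Inc _ => 1
  | Seq c1 c2 | Choice c1 c2 | IfEq _ _ c1 c2 | IfScan _ c1 c2 => growth L c1 + growth L c2
  | For _ _ c => L * (growth L c).+1
  | _ => 0
  end.

Lemma wf_writes c : wf c -> {in writes c, forall r, r = HD \/ 2 < r}.
Proof.
elim: c => //=.
- by move=> r /andP[r2 _] x; rewrite inE => /eqP->; right.
- by move=> r r' /andP[/andP[r2 _] _] x; rewrite inE => /eqP->; right.
- by move=> _ x; rewrite inE => /eqP->; left.
- by move=> _ x; rewrite inE => /eqP->; left.
- by move=> r _ x; rewrite inE => /eqP->; left.
- move=> c1 IH1 c2 IH2 /andP[/IH1 h1 /IH2 h2] x.
  by rewrite mem_cat => /orP[/h1|/h2].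
- move=> c1 IH1 c2 IH2 /andP[/IH1 h1 /IH2 h2] x.
  by rewrite mem_cat => /orP[/h1|/h2].
- move=> r r' c1 IH1 c2 IH2 /and4P[_ _ /IH1 h1 /IH2 h2] x.
  by rewrite mem_cat => /orP[/h1|/h2].
- move=> p c1 IH1 c2 IH2 /andP[/IH1 h1 /IH2 h2] x.
  by rewrite mem_cat => /orP[/h1|/h2].
- move=> r rb c IH /and5P[/andP[r2 _] _ _ _ /IH h] x.
  by rewrite inE => /orP[/eqP->|/h//]; right.
Qed.

(** * Arithmetic of the single passes *)

Section Trd.
Variable w : seq letter.

Lemma trd_inc r q h cs : r <= N ->
  let o := trd w (fun (q : bool) _ c => (q && get r c, put r (q (+) get r c) c, false)) q h cs in
  [/\ o.1.2 = h, size o.2 = size cs,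
      forall r', r' <= N -> r' != r -> vl r' o.2 = vl r' cs &
      vl r o.2 + o.1.1 * 2 ^ size cs = vl r cs + q].
Proof.
move=> rN; elim: cs q h => [|c cs IH] q h /=.
  by split=> //; rewrite muln1.
have := IH (q && get r c) h; case: trd => [[q2 h2] cs2] /= [-> -> fr E].
split=> // [r' r'N r'r|].
  by rewrite /vl /= get_put // (negPf r'r) -/(vl r' cs2) fr.
rewrite /vl /= get_put // eqxx -/(vl r cs2) -/(vl r cs) expnS.
by move: E; case: q; case: (get r c); case: q2 => /=; lia.
Qed.

Lemma trd_copy r r' q h cs : r <= N -> r' <= N ->
  let o := trd w (fun (_ : unit) _ c => (tt, put r (get r' c) c, false)) q h cs in
  [/\ o.1.2 = h, size o.2 = size cs &
      forall x, x <= N -> vl x o.2 = vl (if x == r then r' else x) cs].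
Proof.
move=> rN r'N; elim: cs q h => [|c cs IH] q h //=.
have := IH tt h; case: trd => [[q2 h2] cs2] /= [-> -> fr].
split=> // x xN; rewrite /vl /= get_put // -/(vl x cs2) fr //.
by case: ifP.
Qed.

Lemma trd_eq r r' q h cs :
  trd w (fun q _ c => (q && (get r c == get r' c), c, false)) q h cs =
  (q && (vl r cs == vl r' cs), h, cs).
Proof.
elim: cs q => [|c cs IH] q /=; first by rewrite eqxx andbT.
rewrite IH /vl /= -/(vl r cs) -/(vl r' cs) -andbA; congr (_ && _, _, _).
by case: (get r c); case: (get r' c) => /=; rewrite ?eqxx /=; apply/eqP/eqP; lia.
Qed.

Section Match.
Variable r : nat.
Notation delta := (fun (q : bool * bool) sc c =>
       match sc with
       | Letter (Bit x) => ((q.1 && (x == get r c), x), c, true)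
       | Letter Comma => ((q.1 && q.2 && ~~ get r c, q.2), c, false)
       | _ => ((false, false), c, false)
       end).

Lemma trd_match_tape q h cs : (trd w delta q h cs).2 = cs.
Proof.
elim: cs q h => [|c cs IH] q h //=.
by case: (scan w h) => [||[x||]] /=;
  match goal with |- context [trd _ _ ?q' ?h' cs] =>
    have := IH q' h'; case: (trd _ _ q' h' cs) => [[q2 h2] cs2] /= -> end.
Qed.

Lemma trd_match_bad l h cs : (trd w delta (false, l) h cs).1.1.1 = false.
Proof.
elim: cs l h => [|c cs IH] l h //=.
case: (scan w h) => [||[x||]] /=.
- by have := IH false h; case: trd => [[q2 h2] cs2].
- by have := IH false h; case: trd => [[q2 h2] cs2].
- by have := IH x (minn h.+1 (size w).+1); case: trd => [[q2 h2] cs2].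
- by have := IH l h; case: trd => [[q2 h2] cs2].
- by have := IH false h; case: trd => [[q2 h2] cs2].
Qed.

(** The columns are shared by all registers, so a register may have leading zeros where the input
    has none: once the comma is scanned, only zero digits are tolerated. A number too long for the
    columns fails because the pass does not end on a comma. *)
Lemma trd_match_sound l h cs :
  let o := (trd w delta (true, l) h cs).1 in
  [&& o.1.1, o.1.2 & if scan w o.2 is Letter Comma then true else false] ->
  exists ds, [/\ exists tl, drop h.-1 w = map Bit ds ++ Comma :: tl, last l ds,
                 bval ds = vl r cs, 0 < h & o.2 = h + size ds].
Proof.
elim: cs l h => [|c cs IH] l h /=.
  case: l => //=; case E: (scan w h) => [||[x||]] //= _; have [h0 dE] := scanned_letter E.
  by exists [::]; split => //; [exists (drop h w)|rewrite addn0].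
have bad x h' : ~~ (trd w delta (false, x) h' cs).1.1.1 by rewrite trd_match_bad.
case E: (scan w h) => [||[x||]] /=.
- by have := bad false h; case: trd => [[q2 h2] cs2] /= /negPf->.
- by have := bad false h; case: trd => [[q2 h2] cs2] /= /negPf->.
- have [h0 dE] := scanned_letter E; have [_ hw _] := scan_letter h0 dE.
  have -> : minn h.+1 (size w).+1 = h.+1 by lia.
  case: eqP => [xE|_]; last first.
    by have := bad x h.+1; case: trd => [[q2 h2] cs2] /= /negPf->.
  have := IH x h.+1; case: trd => [[q2 h2] cs2] /= H /H[ds [[tl dE'] ls bv _ ->]].
  exists (x :: ds); split=> //.
  + by exists tl; rewrite dE dE'.
  + by rewrite /vl /= -/(vl r cs) -bv xE.
  + by rewrite addSnnS.
- have [h0 dE] := scanned_letter E.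
  case lc: (l && ~~ get r c); last first.
    by have := bad l h; case: trd => [[q2 h2] cs2] /= /negPf->.
  have /andP[lT /negPf gc] := lc.
  have := IH l h; case: trd => [[q2 h2] cs2] /= H /H[ds [[tl dE'] ls bv _ ->]].
  exists ds; split=> //; first by exists tl.
  move: dE'; rewrite dE; case: ds bv {ls} => [|//] /= bv _.
  by rewrite /vl /= -/(vl r cs) -bv gc.
- by have := bad false h; case: trd => [[q2 h2] cs2] /= /negPf->.
Qed.

Lemma bval_last (l : bool) (ds : seq bool) : last l ds -> bval ds = 0 -> ds = [::] /\ l.
Proof.
elim: ds l => [|x ds IH] l //= ls E.
by have [|d0 x1] := IH x ls; [lia|move: E; rewrite x1].
Qed.

Lemma trd_match_complete l h cs ds tl :
  0 < h -> drop h.-1 w = map Bit ds ++ Comma :: tl -> last l ds -> bval ds = vl r cs ->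
  (trd w delta (true, l) h cs).1 = ((true, true), h + size ds).
Proof.
elim: cs l h ds => [|c cs IH] l h ds h0 dE ls bv /=.
  by have [-> ->] := bval_last ls bv; rewrite addn0.
case: ds dE ls bv => [|x ds] /= dE ls bv.
  have [-> _ _] := scan_letter h0 dE.
  have gc : get r c = false by move: bv; rewrite /vl /=; case: (get r c).
  have bv' : bval [::] = vl r cs by move: bv; rewrite /vl /= gc /=; lia.
  have := IH l h [::] h0 dE ls bv'; rewrite ls gc /=.
  by case: trd => [[q2 h2] cs2] /= ->.
have [-> hw dE'] := scan_letter h0 dE.
have -> : minn h.+1 (size w).+1 = h.+1 by lia.
have [gc bv'] : x = get r c /\ bval ds = vl r cs.
  by move: bv; rewrite /vl /= -/(vl r cs); case: x {dE ls}; case: (get r c); lia.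
have := IH x h.+1 ds isT dE' ls bv'; rewrite -gc eqxx.
by case: trd => [[q2 h2] cs2] /= ->; rewrite addSnnS.
Qed.

End Match.
End Trd.

(** * Correctness of compiled programs *)

Section Correctness.
Variables (w : seq letter) (B : nat).
Notation width := (trunc_log 2 B).+1.
Notation space := (width + 3).
Notation L := (size w).+1.

(** The bound [v] on the register contents grows only with increments, and it is what keeps the tape
    logarithmic. The input head is exempt from it, having no digits on the tape. *)
Record rep (v : nat) (m : mem N) (s : store) : Prop := Rep {
  rep_tape : exists2 cs, tape_is (tp m) cs &
               size cs <= width /\ forall r, 0 < r <= N -> vl r cs = s r;
  rep_wp : wp m = 0;
  rep_hd : hd m = s HD;
  rep_hdL : s HD <= L;
  rep_le : forall r, 0 < r -> s r <= v }.

Lemma rep_mono v v' m s : v <= v' -> rep v m s -> rep v' m s.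
Proof. by move=> le [*]; split=> // r r0; apply: leq_trans le; auto. Qed.

Lemma rep_space v m s : rep v m s -> wp m < space.
Proof. by case=> _ -> *. Qed.

Notation MW := (@MW N w space).

Lemma hd_min v m s : rep v m s -> minn (hd m) L = hd m.
Proof. by case=> _ _ -> le _; apply/minn_idPl. Qed.

Lemma rep_idle v m s : rep v m s -> rep v (perf w (idle (tp m (wp m))) m) s.
Proof.
move=> R; have hE := hd_min R; case: R => -[cs tm [sz vE]] pm hm hL le.
split=> //=; last by rewrite hE.
by exists cs => // p; case: eqP => [->|_]; rewrite tm.
Qed.

Lemma MW_prim_idle b f r0 v m s (Q : bool -> mem N -> Prop) :
  rep v m s -> f (scan w (hd m)) (tp m (wp m)) = [:: (r0, idle (tp m (wp m)))] ->
  (forall m', rep v m' s -> Q r0 m') -> MW b Q (inl (entry (prim f))) m.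
Proof.
move=> R fE Qm; apply: (@MW_prim N w space b f r0 _ Q m fE) => /=; [exact: rep_space R| exact: rep_space R|].
exact: Qm (rep_idle R).
Qed.

Lemma MW_ret b r0 v m s (Q : bool -> mem N -> Prop) :
  rep v m s -> (forall m', rep v m' s -> Q r0 m') -> MW b Q (inl (entry (ret N r0))) m.
Proof. by move=> R; exact: MW_prim_idle R _. Qed.

Lemma MW_flip (b : bool) v m s (Q : bool -> mem N -> Prop) :
  rep v m s ->
  (if b then forall r0 m', rep v m' s -> Q r0 m'
   else exists r0, forall m', rep v m' s -> Q r0 m') ->
  MW b Q (inl (entry (flip N))) m.
Proof.
move=> R; have sp := rep_space R; have R' := rep_idle R; case: b => [H|[r0 H]].
  apply: MW_all => // x a; rewrite /outs /= !inE => /orP[] /eqP[-> ->]; apply: MW_exit => //; exact: H.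
apply: (@MW_some _ _ _ _ _ _ _ _ (inr r0) (idle (tp m (wp m)))) => //.
  by rewrite /outs /= !inE; case: (r0); rewrite eqxx ?orbT.
by apply: MW_exit => //; exact: H.
Qed.

Lemma MW_fail (b : bool) m (Q : bool -> mem N -> Prop) :
  wp m < space -> b -> MW b Q (inl (entry (fail N))) m.
Proof. by move=> sp hb; apply: MW_all. Qed.

Lemma MW_scan b p v m s (Q : bool -> mem N -> Prop) :
  rep v m s -> (forall m', rep v m' s -> Q (p (scan w (s HD))) m') ->
  MW b Q (inl (entry (scanf p))) m.
Proof.
move=> R Qm; refine (@MW_prim_idle b _ (p (scan w (s HD))) _ _ _ _ R _ _) => //.
by rewrite (rep_hd R).
Qed.

Lemma rep_move mv v m s :
  rep v m s ->
  rep v (perf w (mv, tp m (wp m), Stay) m) (upd s HD (minn (shift mv (s HD)) L)).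
Proof.
case=> -[cs tm [sz vE]] pm hm hL le; split=> //=.
- exists cs; first by move=> p; case: eqP => [->|_]; rewrite tm.
  by split=> // -[|r] //; exact: vE.
- by rewrite hm.
- by rewrite /upd /= geq_minr.
- by case=> // r; exact: le.
Qed.

Lemma MW_right b v m s (Q : bool -> mem N -> Prop) :
  rep v m s -> (forall m', rep v m' (upd s HD (minn (s HD).+1 L)) -> Q true m') ->
  MW b Q (inl (entry rightf)) m.
Proof.
move=> R Qm; refine (@MW_prim N w space b _ true (MoveR, tp m (wp m), Stay) _ _ _ _ _ _) => //=;
  [exact: rep_space R|exact: rep_space R|].
by apply: Qm; exact: (rep_move MoveR R).
Qed.

Lemma rep_ext v m s s' : s =1 s' -> rep v m s -> rep v m s'.
Proof.
by move=> E [[cs tm [sz vE]] ? ? ? ?]; split; rewrite -?E //;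
  [exists cs => //; split=> // r rN; rewrite -E vE|move=> r; rewrite -E; auto].
Qed.

Lemma MW_left b v m s (Q : bool -> mem N -> Prop) :
  rep v m s -> (forall m', rep v m' (upd s HD 0) -> Q true m') ->
  MW b Q (inl (entry leftf)) m.
Proof.
move: {2}(s HD) (erefl (s HD)) => h; elim: h s m => [|h IH] s m hE R Qm; apply: MW_loop.
  have sc : scan w (hd m) = LeftEnd by rewrite (rep_hd R) hE.
  refine (@MW_prim_idle b _ false _ _ _ _ R _ _); first by rewrite sc.
  by move=> m' R'; apply: Qm; apply: rep_ext R' => -[|r] //=; rewrite hE.
have sc : scan w (hd m) <> LeftEnd.
  rewrite (rep_hd R) hE /=; case: (ltnP h (size w)) => lt.
    by rewrite (nth_map Comma).
  by rewrite nth_default // size_map.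
refine (@MW_prim N w space b _ true (MoveL, tp m (wp m), Stay) _ _ _ _ _ _) => /=;
  [by case: (scan w (hd m)) sc|exact: rep_space R|exact: rep_space R|].
apply: IH (rep_move MoveL R) _.
  by rewrite /upd /= hE; have := rep_hdL R; lia.
by move=> m' R'; apply: Qm; apply: rep_ext R' => -[|r].
Qed.

Lemma MW_eq b r r' v m s (Q : bool -> mem N -> Prop) :
  rreg r -> rreg r' -> rep v m s ->
  (forall m', rep v m' s -> Q (s r == s r') m') ->
  MW b Q (inl (entry (eqf r r'))) m.
Proof.
move=> rN r'N [[cs tm [sz vE]] pm hm hL le] Qm.
refine (@MW_sweep N w space _ _ _ _ _ b cs _ m tm pm _ _ _); [lia|lia|rewrite trd_eq /= cats0 => m' tm' hm' pm'].
rewrite !vE //; apply: Qm; split=> //; last by rewrite hm'.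
by exists cs.
Qed.

Lemma MW_copy b r r' v m s (Q : bool -> mem N -> Prop) :
  rreg r -> rreg r' -> rep v m s ->
  (forall m', rep v m' (upd s r (s r')) -> Q true m') ->
  MW b Q (inl (entry (copyf r r'))) m.
Proof.
move=> /andP[r2 rN] /andP[r0' r'N] [[cs tm [sz vE]] pm hm hL le] Qm.
refine (@MW_sweep N w space _ _ _ _ _ b cs _ m tm pm _ _ _); [lia|lia|].
have := @trd_copy w r r' tt (hd m) cs rN r'N; case: trd => [[q2 h2] cs2] /= [-> szE fr] m'.
rewrite cats0 => tm' hm' pm'; apply: Qm; split=> //=.
- exists cs2 => //; rewrite szE; split=> // x /andP[x0 xN].
  by rewrite fr // vE /upd; case: eqP => _ //; rewrite ?x0 ?r0'.
- by rewrite hm' /upd; case: eqP => // E; rewrite -E in r2.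
- by rewrite /upd; case: eqP => // E; rewrite -E in r2.
- by move=> x x0; rewrite /upd; case: eqP => _; apply: le.
Qed.

Lemma MW_inc b r v m s (Q : bool -> mem N -> Prop) :
  rreg r -> rep v m s -> v < B ->
  (forall m', rep v.+1 m' (upd s r (s r).+1) -> Q true m') ->
  MW b Q (inl (entry (incf r))) m.
Proof.
move=> /andP[r2 rN] [[cs tm [sz vE]] pm hm hL le] vB Qm.
refine (@MW_sweep N w space _ _ _ _ _ b cs _ m tm pm _ _ _); [lia|lia|].
have := @trd_inc w r true (hd m) cs rN; case: trd => [[q2 h2] cs2] /= [-> szE fr E] m' tm' hm' pm'.
apply: Qm.
have vr : vl r cs = s r by apply: vE; lia.
have sv : s r <= v by apply: le; lia.
have vcat x ds : vl x (cs2 ++ ds) = vl x cs2 + 2 ^ size cs2 * vl x ds.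
  elim: (cs2) => [|c ds' IH] /=; first by rewrite add0n mul1n.
  by rewrite /vl /= -!/(vl _ _) IH expnS -mulnA mul2n doubleD addnA.
split=> //=.
- exists (cs2 ++ seq_of_opt (if q2 then Some [ffun i : 'I_N.+1 => val i == r] else None)) => //.
  split.
    rewrite size_cat szE; case: q2 E {tm'} => /= E; last by rewrite addn0.
    (* A column is added only if the carry survives, and then
       [2 ^ size cs <= s r + 1 <= v + 1 <= B], so the longer tape still fits. *)
    rewrite addn1 ltnS; apply: trunc_log_max => //.
    have : 2 ^ size cs <= vl r cs + 1 by rewrite -E mul1n leq_addl.
    by rewrite vr; lia.
  move=> x /andP[x0 xN]; rewrite vcat szE.
  case: (eqVneq x r) => [->|xr].
    rewrite /upd eqxx; have -> : (s r).+1 = vl r cs2 + q2 * 2 ^ size cs by rewrite E vr addn1.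
    congr (_ + _).
    case: q2 {E tm'} => /=; last by rewrite muln0.
    by rewrite mul1n /vl /= /get ffunE /= inordK // eqxx /= muln1.
  rewrite fr // vE ?x0 // /upd (negPf xr).
  suff -> : vl x (seq_of_opt (if q2 then Some [ffun i : 'I_N.+1 => val i == r] else None)) = 0.
    by rewrite muln0 addn0.
  by case: q2 {E tm'} => //; rewrite /vl /= /get ffunE /= inordK // (negPf xr).
- by rewrite hm' /upd; case: eqP => // E'; rewrite -E' in r2.
- by rewrite /upd; case: eqP => // E'; rewrite -E' in r2.
- by move=> x x0; rewrite /upd; case: eqP => _; [rewrite ltnS|apply: leqW]; apply: le; lia.
Qed.

Arguments MW_ret {b r0 v m s Q}.
Arguments MW_flip {b v m s Q}.
Arguments MW_fail {b m Q}.
Arguments MW_scan {b p v m s Q}.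
Arguments MW_right {b v m s Q}.
Arguments MW_left {b v m s Q}.
Arguments MW_eq {b r r' v m s Q}.
Arguments MW_copy {b r r' v m s Q}.
Arguments MW_inc {b r v m s Q}.

Lemma MW_match {b} r v m s (Q : store -> Prop) :
  rreg r -> rep v m s -> W w b (MatchA r) Q s ->
  MW b (fun _ m' => exists2 s', Q s' & rep v m' s' ) (inl (entry (comp (MatchA r)))) m.
Proof.
move=> rN R; have [[cs tm [sz vE]] pm hm hL le] := R.
move=> Wm; apply: MW_ite.
refine (@MW_sweep N w space _ _ _ _ _ b cs _ m tm pm _ _ _); [lia|lia|].
have := @trd_match_tape w r (true, false) (hd m) cs.
have := @trd_match_sound w r false (hd m) cs.
have := @trd_match_complete w r false (hd m) cs.
case: trd => [[[ok l] h2] cs2] /=; rewrite hm => compl snd -> m'; rewrite cats0 => tm' hm' pm'.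
have vr : vl r cs = s r by apply: vE; rewrite /rreg in rN.
have repm (ds : seq bool) : h2 = s HD + size ds -> s HD + size ds <= L ->
    rep v m' (upd s HD (s HD + size ds)).
  move=> E leL; split=> //=; last by case=> // x x0; apply: le.
    by exists cs => //; split=> // -[|x] //; apply: vE.
  by rewrite hm' E.
have hds h ds tl : 0 < h -> drop h.-1 w = map Bit ds ++ Comma :: tl -> h + size ds <= L.
  move=> h0 E; have : size (drop h.-1 w) = size (map Bit ds ++ Comma :: tl) by rewrite E.
  by rewrite size_drop size_cat size_map /=; lia.
case: ifP => [okE|nok]; last first.
  apply: MW_fail; first by rewrite pm'; lia.
  case: b Wm => //= -[ds [h0 [tl dE] ls bv] _].
  have [ok1 l1 h2E] : (ok, l, h2) = (true, true, s HD + size ds).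
    by apply: compl h0 dE ls _; rewrite vr.
  move: nok; rewrite ok1 l1 h2E /=.
  suff -> : scan w (s HD + size ds) = Letter Comma by [].
  suff : drop (s HD + size ds).-1 w = Comma :: tl by case/scan_letter => //; lia.
  have -> : (s HD + size ds).-1 = size (map Bit ds) + (s HD).-1 by rewrite size_map; lia.
  by rewrite -drop_drop dE drop_size_cat.
case: b Wm => /= [Wm|[ds [h0 [tl dE] ls bv] Qds]].
  have {snd}[ds [[tl dE] ls bv h0 hE]] := snd okE.
  have R2 := repm ds hE (hds _ _ _ h0 dE).
  apply: (MW_ret R2) => m'' R3; exists (upd s HD (s HD + size ds)) => //.
  by apply: Wm; split=> //; [exists tl|rewrite bv vr].
have [ok1 l1 h2E] : (ok, l, h2) = (true, true, s HD + size ds).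
  by apply: compl h0 dE ls _; rewrite vr.
have R2 := repm ds h2E (hds _ _ _ h0 dE).
by apply: (MW_ret R2) => m'' R3; exists (upd s HD (s HD + size ds)).
Qed.

Notation "Q =>> v" := (fun _ m' => exists2 s', Q s' & rep v m' s') (at level 50).

Lemma wreg_rreg r : wreg r -> rreg r.
Proof. by rewrite /wreg /rreg => /andP[r2 ->]; rewrite andbT; lia. Qed.

Lemma wf_fixed c s s' : wf c -> same_off (writes c) s s' -> s' LEN = s LEN /\ s' ZR = s ZR.
Proof.
by move=> /wf_writes rw fr; split; apply: fr; apply/negP => /rw[].
Qed.

Hypothesis N2 : 2 < N.

(** Induction on the command, with [growth] paid out of the distance between [v] and [B]. [LEN] and
    [ZR] keep their values because well-formed commands do not write them. *)
Lemma MW_comp b c (Q : store -> Prop) s m v :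
  wf c -> s LEN = L -> s ZR = 0 -> rep v m s -> v + growth L c <= B -> W w b c Q s ->
  MW b (Q =>> (v + growth L c)) (inl (entry (comp c))) m.
Proof.
elim: c Q s m v => [||r|r r'|||r|c1 IH1 c2 IH2|c1 IH1 c2 IH2|r r' c1 IH1 c2 IH2
  |p c1 IH1 c2 IH2|r rb c IH] Q s m v /=; rewrite ?addn0.
- by move=> _ sL sZ R _ Qs; apply: (MW_ret R) => m' R'; exists s.
- by move=> _ sL sZ R _ hb; apply: MW_fail => //; exact: rep_space R.
- move=> /wreg_rreg wr sL sZ R vB Qs; rewrite addn1 in vB *; apply: (MW_inc wr R) => // m' R'.
  by exists (upd s r (s r).+1).
- move=> /andP[/wreg_rreg wr rr'] sL sZ R _ Qs; apply: (MW_copy wr rr' R) => m' R'.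
  by exists (upd s r (s r')).
- by move=> _ sL sZ R _ Qs; apply: (MW_left R) => m' R'; exists (upd s HD 0).
- move=> _ sL sZ R _ Qs; apply: (MW_right R) => m' R'.
  by exists (upd s HD (minn (s HD).+1 L)).
- by move=> rr sL sZ R _ /(MW_match rr R).
- move=> /andP[wf1 wf2] sL sZ R le Ws; apply: MW_seq.
  have /(IH1 _ _ _ _ wf1 sL sZ R) h := W_frame Ws.
  apply: MW_mono (h _) => [_ m' [s' [Ws' fr] R']|]; last lia.
  have [fL fZ] := wf_fixed wf1 fr.
  by rewrite addnA; apply: IH2 R' _ Ws' => //; rewrite ?fL ?fZ //; lia.
- move=> /andP[wf1 wf2] sL sZ R le Ws; apply: MW_ite.
  have h1 m' : rep v m' s -> W w b c1 Q s ->
      MW b (Q =>> (v + (growth L c1 + growth L c2))) (inl (entry (comp c1))) m'.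
    move=> R' /(IH1 _ _ _ _ wf1 sL sZ R') h; apply: MW_mono (h _) => [_ m'' [s' q R2]|]; last lia.
    by exists s' => //; apply: rep_mono R2; lia.
  have h2 m' : rep v m' s -> W w b c2 Q s ->
      MW b (Q =>> (v + (growth L c1 + growth L c2))) (inl (entry (comp c2))) m'.
    move=> R' /(IH2 _ _ _ _ wf2 sL sZ R') h; apply: MW_mono (h _) => [_ m'' [s' q R2]|]; last lia.
    by exists s' => //; apply: rep_mono R2; lia.
  apply: (MW_flip R); case: b h1 h2 Ws {IH1 IH2} => h1 h2 Ws.
    by move=> [] m' R'; case: Ws => w1 w2; [exact: h1|exact: h2].
  by case: Ws => Ws; [exists true|exists false] => m' R'; [exact: h1|exact: h2].
- move=> /and4P[rr rr' wf1 wf2] sL sZ R le Ws; apply: MW_ite.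
  apply: (MW_eq rr rr' R) => m' R'; case: ifP Ws => _.
    move=> /(IH1 _ _ _ _ wf1 sL sZ R') h; apply: MW_mono (h _) => [_ m'' [s' q R2]|]; last lia.
    by exists s' => //; apply: rep_mono R2; lia.
  move=> /(IH2 _ _ _ _ wf2 sL sZ R') h; apply: MW_mono (h _) => [_ m'' [s' q R2]|]; last lia.
  by exists s' => //; apply: rep_mono R2; lia.
- move=> /andP[wf1 wf2] sL sZ R le Ws; apply: MW_ite.
  apply: (MW_scan R) => m' R'; case: ifP Ws => _.
    move=> /(IH1 _ _ _ _ wf1 sL sZ R') h; apply: MW_mono (h _) => [_ m'' [s' q R2]|]; last lia.
    by exists s' => //; apply: rep_mono R2; lia.
  move=> /(IH2 _ _ _ _ wf2 sL sZ R') h; apply: MW_mono (h _) => [_ m'' [s' q R2]|]; last lia.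
  by exists s' => //; apply: rep_mono R2; lia.
move=> /and5P[wr rrb rF rbF wfc] sL sZ R le Ws; apply: MW_seq.
have zrr : rreg ZR by rewrite /rreg /ZR; lia.
have lnr : rreg LEN by rewrite /rreg /LEN; lia.
have rr := wreg_rreg wr.
have [rrb' rnc] : r != rb /\ r \notin writes c.
  by move: rF; rewrite inE negb_or => /andP[].
apply: (MW_copy rr zrr R) => m'; rewrite sZ => R'.
move: Ws; set k := minn _ _; set F := fun _ => _ => Ws.
have gr : v + k * (growth L c).+1 <= B.
  apply: leq_trans le; rewrite leq_add2l leq_mul2r; apply/orP; right; exact: geq_minr.
suff : MW b (Q =>> (v + k * (growth L c).+1))
    (inl (entry (loop (ite (eqf r rb) (ret N false)
               (ite (eqf r LEN) (ret N false) (seqf (comp c) (incf r))))))) m'.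
  apply: MW_mono => _ m'' [s' q R2]; exists s' => //; apply: rep_mono R2.
  by rewrite leq_add2l leq_mul2r; apply/orP; right; exact: geq_minr.
(* From here on [k] is the number of rounds still to come. Both exit tests fail exactly as long as
   it is positive, because counter plus [k] is the smaller of bound and cap. *)
have : upd s r 0 r + k = minn (upd s r 0 rb) L.
  by rewrite {1}/upd eqxx /k /upd eq_sym (negPf rrb').
have [fL fZ] : LEN != r /\ ZR != r.
  by case/andP: wr => r2 _; rewrite /LEN /ZR; lia.
have : upd s r 0 ZR = 0 by rewrite /upd (negPf fZ).
have : upd s r 0 LEN = L by rewrite /upd (negPf fL).
clear sL sZ; clearbody k; move: (upd s r 0) m' Ws R' => {R m le s} s m Ws R sL sZ kE.
elim: k v m s Ws R sL sZ kE gr => [|k IHk] v m s /= Ws R sL sZ kE gr; apply: MW_loop; apply: MW_ite.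
  apply: (MW_eq rr rrb R) => m1 R1.
  have done' m' : rep v m' s -> MW b (fun r0 m'' => if r0 then
      MW b (Q =>> (v + 0 * (growth L c).+1)) (inl (entry (loop (ite (eqf r rb) (ret N false)
               (ite (eqf r LEN) (ret N false) (seqf (comp c) (incf r))))))) m''
      else (Q =>> (v + 0 * (growth L c).+1)) true m'') (inl (entry (ret N false))) m'.
    by move=> R'; apply: (MW_ret R') => m'' R2; exists s; rewrite ?mul0n ?addn0.
  case: eqP => [_|ne]; first exact: done'.
  apply: MW_ite; apply: (MW_eq rr lnr R1) => m2 R2; rewrite sL.
  have -> : s r == L by apply/eqP; move: kE; lia.
  exact: done'.
apply: (MW_eq rr rrb R) => m1 R1.
have -> : (s r == s rb) = false by apply/eqP; lia.
apply: MW_ite; apply: (MW_eq rr lnr R1) => m2 R2; rewrite sL.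
have -> : (s r == L) = false by apply/eqP; lia.
apply: MW_seq; have := IH _ _ _ v wfc sL sZ R2 _ (W_frame Ws).
move=> h; apply: MW_mono (h _) => [_ m3 [s1 [Ws1 fr] R3]|]; last by lia.
apply: (MW_inc rr R3) => [|m4 R4]; first by lia.
have -> : v + k.+1 * (growth L c).+1 = (v + growth L c).+1 + k * (growth L c).+1 by lia.
have [sL1 sZ1] := wf_fixed wfc fr.
apply: IHk (Ws1) R4 _ _ _ _; [| | |lia].
- by rewrite /upd (negPf fL) sL1.
- by rewrite /upd (negPf fZ) sZ1.
rewrite /upd eqxx eq_sym (negPf rrb') !fr //; lia.
Qed.

End Correctness.
End Compile.

Arguments MW_ret {N w B b r0 v m s Q}.
Arguments MW_scan {N w B b p v m s Q}.
Arguments MW_right {N w B b v m s Q}.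
Arguments MW_inc {N w B b r v m s Q}.

(** * From fragments to Turing machines *)

Section Machine.
Variables (N : nat) (F : frag N).

Definition machine_trans (q : ctl F + bool) (sc : scanned letter)
    (syms : {ffun 'I_1 -> sym N}) (a : action (ctl F + bool)%type (sym N) 1) : bool :=
  if q is inl q then
    (next_state a, (input_move a, work_write a ord0, work_move a ord0))
      \in tr q sc (syms ord0)
  else false.

(** Every exit accepts, whatever its bit; rejection is a dead end inside the fragment. *)
Definition machine : ntm letter :=
  @NTM letter (ctl F + bool)%type (sym N) 1 None (inl (entry F))
    (fun q => if q is inr _ then true else false) machine_trans.

Variables (w : seq letter) (space : nat).

Definition mem_of (c : config machine) : mem N :=
  Mem (input_head c) (tape c ord0) (work_head c ord0).

Lemma machine_step (c c' : config machine) : step w c c' ->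
  exists q a, [/\ cstate c = inl q, (cstate c', a) \in outs w q (mem_of c) &
                  mem_of c' = perf w a (mem_of c)].
Proof.
case=> a; rewrite /= /machine_trans; case E: (cstate c) => [q|] //= + ->.
rewrite ffunE => h; exists q, (input_move a, work_write a ord0, work_move a ord0).
by split.
Qed.

Lemma machine_stepI (c : config machine) q x a :
  cstate c = inl q -> (x, a) \in outs w q (mem_of c) ->
  exists c', [/\ step w c c', cstate c' = x & mem_of c' = perf w a (mem_of c)].
Proof.
move=> E xa.
pose ac := @Action (state machine) (symbol machine) (ntapes machine) x a.1.1
  [ffun=> a.1.2] [ffun=> a.2].
exists (perform w c ac); split=> //.
  by exists ac => //=; rewrite /machine_trans E !ffunE -!surjective_pairing.
by rewrite /mem_of /perf /= !ffunE.
Qed.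

Lemma machine_halted (c : config machine) r : cstate c = inr r -> halted w c.
Proof. by move=> E c' /machine_step[q [a []]]; rewrite E. Qed.

(** For [b = true] a derivation of [MW] is the well-founded tree of all runs, so one induction gives
    halting, the space bound and the postcondition. *)
Lemma MW_true Q x m (c : config machine) :
  MW w space true Q x m -> cstate c = x -> mem_of c = m ->
  Acc (fun c2 c1 => step w c1 c2) c /\
  forall c', clos_refl_trans _ (@step _ machine w) c c' ->
    work_head c' ord0 < space /\ forall r, cstate c' = inr r -> Q r (mem_of c').
Proof.
move=> mw; elim: mw c => {x m} [r m sp q|q m _ sp _ IH|//] c cx cm.
  have hc := machine_halted cx; split; first by split=> c' /hc.
  move=> c' /clos_rt_rt1n_iff [|c1 c2 /hc//].
  split=> [|r']; first by rewrite -cm in sp.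
  by rewrite cx cm => -[<-].
have next c1 : step w c c1 -> Acc (fun c2 c1 => step w c1 c2) c1 /\
  forall c', clos_refl_trans _ (@step _ machine w) c1 c' ->
    work_head c' ord0 < space /\ forall r, cstate c' = inr r -> Q r (mem_of c').
  move/machine_step => [q' [a [E xa mE]]]; move: E xa mE; rewrite cx cm => -[<-] xa mE.
  exact: IH xa _ (erefl _) mE.
split; first by split=> c1 /next[].
move=> c' /clos_rt_rt1n_iff; case=> [|c1 c2 st /clos_rt_rt1n_iff rt].
  by split; [rewrite -cm in sp|rewrite cx].
exact: (next _ st).2.
Qed.

Lemma MW_false Q x m (c : config machine) :
  MW w space false Q x m -> cstate c = x -> mem_of c = m ->
  exists c' r, [/\ clos_refl_trans _ (@step _ machine w) c c', cstate c' = inr r &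
                   Q r (mem_of c')].
Proof.
move=> mw; elim: mw c => {x m} [r m sp q|//|q m x a _ sp xa _ IH] c cx cm.
  by exists c, r; split=> //; [exact: rt_refl|rewrite cm].
rewrite -cm in xa; have [c1 [st c1x c1m]] := machine_stepI cx xa.
have [c' [r [rt c'r Qr]]] := IH c1 c1x (etrans c1m (congr1 _ cm)).
by exists c', r; split=> //; apply: rt_trans (rt_step _ _ _ _ st) rt.
Qed.

End Machine.

Fixpoint degree (c : cmd) : nat :=
  match c with
  | Seq c1 c2 | Choice c1 c2 | IfEq _ _ c1 c2 | IfScan _ c1 c2 => (degree c1 + degree c2).+1
  | For _ _ c => (degree c).+2
  | _ => 1
  end.

(** The base [L.+2] is at least 2, so one more factor absorbs a sum and two more absorb a loop; this
    dictates the recursion of [degree]. *)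
Lemma growth_le L c : growth L c <= L.+2 ^ degree c.
Proof.
have sum_le a b x y : x <= L.+2 ^ a -> y <= L.+2 ^ b -> x + y <= L.+2 ^ (a + b).+1.
  move=> xa yb; have le1 k : 0 < L.+2 ^ k by rewrite expn_gt0.
  have xab : x <= L.+2 ^ (a + b).
    by apply: leq_trans xa _; rewrite expnD leq_pmulr.
  have yab : y <= L.+2 ^ (a + b).
    by apply: leq_trans yb _; rewrite expnD leq_pmull.
  by rewrite expnS; nia.
elim: c => //= [c1 IH1 c2 IH2|c1 IH1 c2 IH2|r r' c1 IH1 c2 IH2|p c1 IH1 c2 IH2|r rb c IH].
1-4: exact: sum_le.
have : 0 < L.+2 ^ degree c by rewrite expn_gt0.
by rewrite !expnS; nia.
Qed.

(** * Initialization and the space bound *)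

Section Assembly.
Variables (N : nat) (c : cmd).

(** Measuring the input leaves the head on the right end marker, whose position is the length plus
    one; hence [HD] starts with the same value as [LEN]. *)
Definition init (w : seq letter) : store := fun r => if r <= LEN then (size w).+1 else 0.

Definition markf : frag N := prim (fun _ (sy : sym N) => [:: (true, (Stay, mark N, Stay))]).
Definition lenf : frag N :=
  loop (ite (scanf N (fun sc => if sc is RightEnd then false else true))
          (seqf (incf N LEN) (rightf N)) (ret N false)).
Definition program : frag N := seqf markf (seqf lenf (comp N c)).

Hypothesis N2 : 2 < N.

Lemma MW_program b w B (Q : bool -> mem N -> Prop) :
  (size w).+1 <= B ->
  (forall m, rep w B (size w).+1 m (init w) ->
     MW w ((trunc_log 2 B).+1 + 3) b Q (inl (entry (comp N c))) m) ->
  MW w ((trunc_log 2 B).+1 + 3) b Q (inl (entry program)) (Mem 0 (fun=> None) 0).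
Proof.
set space := _ + 3 => LB mw; apply: MW_seq.
refine (@MW_prim N w space b _ true (Stay, mark N, Stay) _ _ _ _ _ _) => //=; try by lia.
apply: MW_seq; set m0 := perf _ _ _.
pose s i : store := fun r => if r <= LEN then i else 0.
have R0 : rep w B 0 m0 (s 0).
  split=> //=; last by move=> r; rewrite /s; case: ifP.
  exists [::]; first by case=> [|p] //=; rewrite nth_nil.
  by split=> // r _; rewrite /s; case: ifP.
have lnr : rreg N LEN by rewrite /rreg /LEN; lia.
(* Generalizes 0 to the common value [i] of head and [LEN], for an induction on the distance to the
   right end marker. *)
have : exists2 k, k = 0 & rep w B k m0 (s k) by exists 0.
case=> i i0; have : i <= (size w).+1 by rewrite i0.
move: m0 {R0 i0}; move: {2}(_ - i) (erefl ((size w).+1 - i)) => k.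
elim: k i => [|k IH] i ki le m R.
  have iE : i = (size w).+1 by lia.
  apply: MW_loop; apply: MW_ite; apply: (MW_scan R) => m1 R1.
  rewrite /s /= iE /= nth_default ?size_map //.
  by apply: (MW_ret R1) => m2 R2; apply: mw; rewrite iE in R2.
have lt : i < (size w).+1 by lia.
apply: MW_loop; apply: MW_ite; apply: (MW_scan R) => m1 R1.
have -> : (if scan w (s i HD) is RightEnd then false else true) = true.
  rewrite /s /=; case E: i lt => //= lt.
  by rewrite (nth_map Comma).
apply: MW_seq; apply: (MW_inc lnr R1) => [|m2 R2]; first lia.
apply: (MW_right R2) => m3 R3; apply: (IH i.+1) => //; first lia.
apply: rep_ext R3 => r; rewrite /s /upd.
case: eqP => [->|/= r0] /=; first by lia.
by case: eqP => [->|r1] //; case: r r0 r1 => [|[|r]].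
Qed.

Lemma NL_cmd (P : seq letter -> Prop) :
  wf N c -> (forall w, W w true c (fun _ => P w) (init w)) ->
  (forall w, P w -> W w false c (fun _ => True) (init w)) -> NL P.
Proof.
move=> wfc Wt Wf; exists (machine program), (2 * (degree c).+2 + 5) => w.
set B := (size w).+1 + growth (size w).+1 c.
set space := (trunc_log 2 B).+1 + 3.
(* It is shown that [B <= 2 ^ (t.+2 * d.+2)]. The factor [2 * d.+2] comes from [t.+2 <= 2 * t.+1],
   and the 5 absorbs the four additional cells. *)
have sp : space <= (2 * (degree c).+2 + 5) * (trunc_log 2 (size w)).+1.
  rewrite /space; set t := trunc_log 2 (size w); set d := degree c.
  have wt : (size w).+3 <= 2 ^ t.+2.
    have : size w < 2 ^ t.+1 by apply: trunc_log_ltn.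
    have : 0 < 2 ^ t by rewrite expn_gt0.
    by rewrite (expnS 2 t.+1) (expnS 2 t); lia.
  have BE : B <= 2 ^ (t.+2 * d.+2).
    have h1 : growth (size w).+1 c <= (size w).+3 ^ d by exact: growth_le.
    have h2 : (size w).+3 ^ d.+2 <= 2 ^ (t.+2 * d.+2) by rewrite expnM leq_exp2r.
    apply: leq_trans h2; rewrite /B !expnS.
    have : 0 < (size w).+3 ^ d by rewrite expn_gt0.
    by nia.
  have : trunc_log 2 B <= t.+2 * d.+2.
    by rewrite -(trunc_expnK (t.+2 * d.+2) (isT : 1 < 2)); exact: leq_trunc_log.
  by nia.
have main b (Q : Prop) : W w b c (fun _ => Q) (init w) ->
    MW w space b (fun _ _ => Q) (inl (entry program)) (Mem 0 (fun=> None) 0).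
  move=> Wc; apply: MW_program => [|m R]; first exact: leq_addr.
  by apply: MW_mono (MW_comp N2 wfc _ _ R _ Wc) => // _ m' [].
have [acc fin] := MW_true (main true _ (Wt w)) (erefl (cstate (initial _))) (erefl _).
split.
- exact: acc.
- by move=> c' /fin[lt _] i; rewrite ord1; apply: leq_trans sp.
split=> [/Wf Wc|[c' [rc _ ac]]].
  have [c' [r [rc c'r _]]] := MW_false (main false _ Wc) (erefl (cstate (initial _))) (erefl _).
  by exists c'; split=> //; [exact: machine_halted c'r|rewrite c'r].
by case E: (cstate c') ac => [|r] //= _; exact: (fin _ rc).2 _ E.
Qed.

End Assembly.

(** * Words encoding tables *)

(** Untyped copies of the encodings: while a word is being parsed, [n] is only a register value and
    no type ['I_n] is at hand. Points count from 0 here and from 1 in the word. *)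
Definition encP (y : nat) : seq letter := rcons (map Bit (binary y.+1)) Comma.
Definition encT (ys : seq nat) : seq letter := rcons (flatten (map encP ys)) Semicolon.
Definition encI (tb : seq (seq nat)) : seq letter := flatten (map encT tb).

Definition table_ok n (ys : seq nat) := (size ys == n) && all (fun y => y < n) ys.
Definition valid k n (tb : seq (seq nat)) :=
  [/\ 0 < k, 0 < n, size tb = k & all (table_ok n) tb].

(** What is left after the [m]-th letter satisfying [p], or nothing if there are fewer; the head
    movement of [skipto]. *)
Fixpoint skipf (p : pred letter) m (s : seq letter) : seq letter :=
  if m is m'.+1 then
    if s is a :: s then skipf p (if p a then m' else m) s else [::]
  else s.

Definition is_comma (a : letter) := if a is Comma then true else false.
Definition is_semi (a : letter) := if a is Semicolon then true else false.

Lemma skipf0 p s : skipf p 0 s = s. Proof. by case: s. Qed.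

Lemma skipf_none p m s t : ~~ has p s -> skipf p m.+1 (s ++ t) = skipf p m.+1 t.
Proof. by elim: s => //= a s IH /norP[/negPf-> /IH]. Qed.

Lemma skipf_one p m s a t : ~~ has p s -> p a -> skipf p m.+1 (s ++ a :: t) = skipf p m t.
Proof. by move=> /skipf_none-> /= ->. Qed.

Lemma skipf_flatten p (T : Type) (f : T -> seq letter) m l t :
  (forall x, exists s a, [/\ f x = rcons s a, ~~ has p s & p a]) -> m <= size l ->
  skipf p m (flatten (map f l) ++ t) = flatten (map f (drop m l)) ++ t.
Proof.
move=> fP; elim: m l => [|m IH] [|x l] //= le; rewrite ?skipf0 //.
have [s [a [-> sp pa]]] := fP x.
by rewrite -catA cat_rcons skipf_one // IH.
Qed.

Lemma has_map_bits p ds : (forall b, ~~ p (Bit b)) -> ~~ has p (map Bit ds).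
Proof. by move=> pB; elim: ds => //= d ds IH; rewrite negb_or pB IH. Qed.

Lemma skip_semis j tb : j <= size tb -> skipf is_semi j (encI tb) = encI (drop j tb).
Proof.
move=> le; rewrite -[encI tb]cats0 -[RHS]cats0; apply: skipf_flatten => // ys.
exists (flatten (map encP ys)), Semicolon; split=> //.
elim: ys => //= y ys IH; rewrite has_cat negb_or IH andbT has_rcons negb_or /=.
exact: has_map_bits.
Qed.

Lemma skip_commas i ys t : i <= size ys ->
  skipf is_comma i (encT ys ++ t) = flatten (map encP (drop i ys)) ++ Semicolon :: t.
Proof.
move=> le; rewrite /encT cat_rcons; apply: skipf_flatten => // y.
exists (map Bit (binary y.+1)), Comma; split=> //; exact: has_map_bits.
Qed.

Lemma bits_comma_inj ds ds' t t' :
  map Bit ds ++ Comma :: t = map Bit ds' ++ Comma :: t' -> ds = ds' /\ t = t'.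
Proof. by elim: ds ds' => [|d ds IH] [|d' ds'] //= [] // -> /IH[-> ->]. Qed.

Lemma binary_rec m : 0 < m -> binary m = odd m :: binary m./2.
Proof.
move=> m0; rewrite /binary.
rewrite up_log2S //.
rewrite /mkseq /= expn0 divn1; congr (_ :: _).
rewrite -[1]addn0 iotaDl -map_comp; apply: eq_map => j /=.
by rewrite add1n expnS divnMA divn2.
Qed.

Lemma binary0 : binary 0 = [::]. Proof. by []. Qed.

Lemma bval_binary m : bval (binary m) = m.
Proof.
elim/ltn_ind: m => -[|m] IH //.
have lt : m.+1./2 < m.+1 by lia.
by rewrite binary_rec // -[in RHS](odd_double_half m.+1) -[in RHS](IH _ lt).
Qed.

Lemma last_binary m : 0 < m -> last false (binary m).
Proof.
elim/ltn_ind: m => -[|m] // IH _; rewrite binary_rec //=.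
case: m IH => [|m] IH; first by rewrite binary0.
have := IH m.+2./2; case: (binary m.+2./2) (@binary_rec m.+2./2 isT) => // x l _ /=.
by apply=> //=; lia.
Qed.

(** Without leading zeros a number has a single spelling, so matching by value cannot let a word
    pass that is not an encoding. *)
Lemma binary_bval ds : last false ds -> binary (bval ds) = ds.
Proof.
elim: ds => //= d ds IH ld.
have h : bval ds = 0 -> ds = [::] by move/(bval_last ld) => -[].
have bE : 0 < d + (bval ds).*2.
  case: (posnP (bval ds)) => [/[dup]|]; last by lia.
  by move=> /h dsE ->; move: ld; rewrite dsE /= => ->.
rewrite binary_rec // oddD odd_double addbF oddb; congr (_ :: _).
rewrite half_bit_double; case: ds IH ld {h bE} => [|d' ds] IH ld //.
by apply: IH.
Qed.

Lemma block_atE w h v m t ds :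
  0 < m -> drop h.-1 w = map Bit (binary m) ++ Comma :: t ->
  block_at w h v ds -> ds = binary m /\ v = m.
Proof.
move=> m0 E [h0 [tl]]; rewrite E => /bits_comma_inj[<- _] _ <-.
by rewrite bval_binary.
Qed.

Lemma block_at_binary w h m t :
  0 < h -> 0 < m -> drop h.-1 w = map Bit (binary m) ++ Comma :: t ->
  block_at w h m (binary m).
Proof. by move=> h0 m0 E; split; rewrite ?last_binary ?bval_binary //; exists t. Qed.

(** * Nested loops and table lookup *)

Arguments W : simpl never.

(** Lexicographic order is the one in which nested loops run through their counters. *)
Fixpoint tuples m n : seq (seq nat) :=
  if m is m'.+1 then [seq i :: v | i <- iota 0 n, v <- tuples m' n] else [:: [::]].

Fixpoint nest (rs : seq nat) rb c :=
  if rs is r :: rs' then For r rb (nest rs' rb c) else c.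

Lemma writes_nest rs rb c : writes (nest rs rb c) = rs ++ writes c.
Proof. by elim: rs => //= r rs ->. Qed.

Lemma same_off_sub l l' s s' : {subset l <= l'} -> same_off l s s' -> same_off l' s s'.
Proof. by move=> sub f r rl; apply: f; apply: contra rl => /sub. Qed.

Lemma same_off_trans l s1 s2 s3 : same_off l s1 s2 -> same_off l s2 s3 -> same_off l s1 s3.
Proof. by move=> f1 f2 r rl; rewrite f2 ?f1. Qed.

Lemma same_off_map l rs s s' :
  same_off l s s' -> all (fun r => r \notin l) rs -> map s' rs = map s rs.
Proof. by move=> f; elim: rs => //= r rs IH /andP[rl /IH->]; rewrite f. Qed.

Lemma same_off_upd l r v s : r \in l -> same_off l s (upd s r v).
Proof. by move=> rl x xl; rewrite /upd; case: eqP => // E; rewrite E rl in xl. Qed.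

Lemma tuples_split m n i l t l' :
  i < n -> tuples m n = l ++ t :: l' ->
  exists l2, tuples m.+1 n =
    ([seq j :: v | j <- iota 0 i, v <- tuples m n] ++ map (cons i) l) ++ (i :: t) :: l2.
Proof.
move=> lt E.
have nE : iota 0 n = iota 0 i ++ i :: iota i.+1 (n - i.+1).
  by rewrite -{1}(subnKC lt) addSnnS iotaD.
exists (map (cons i) l' ++ [seq j :: v | j <- iota i.+1 (n - i.+1), v <- tuples m n]).
by rewrite /= nE allpairs_cat /= {2}E map_cat /= -!catA.
Qed.

Section Rules.
Variable w : seq letter.
Notation L := (size w).+1.

(** Nested loops become one loop over a list of tuples, the invariant being indexed by the prefix
    already treated. The counters change between two rounds, so the invariant must not depend on
    them. *)
Lemma W_nest b n rs rb c (I : seq (seq nat) -> store -> Prop) (Q : store -> Prop) s :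
  uniq rs -> all (fun r => r \notin rb :: writes c) rs -> rb \notin writes c ->
  s rb = n -> n <= L ->
  (forall l s1 s2, I l s1 -> same_off rs s1 s2 -> I l s2) ->
  (forall l t l' s0, tuples (size rs) n = l ++ t :: l' -> map s0 rs = t ->
     same_off (rs ++ writes c) s s0 -> I l s0 -> W w b c (I (rcons l t)) s0) ->
  I [::] s ->
  (forall s', same_off (rs ++ writes c) s s' -> I (tuples (size rs) n) s' -> Q s') ->
  W w b (nest rs rb c) Q s.
Proof.
move=> + + rbc + nL; elim: rs I Q s => [|r rs IH] I Q s.
  move=> _ _ _ _ body I0 IQ; apply: W_spec (body [::] [::] [::] s _ _ _ I0) _ => //.
  by move=> s' Is' f; exact: IQ.
rewrite /= => /andP[rrs urs] /andP[+ ars] srb Ioff body I0 IQ.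
rewrite inE negb_or => /andP[rrb rc].
have rn : r \notin rs ++ writes c by rewrite mem_cat negb_or rrs.
pose A i := [seq j :: v | j <- iota 0 i, v <- tuples (size rs) n].
have rbrs : rb \notin rs.
  by apply/negP => /(allP ars); rewrite inE eqxx.
apply: (@W_for _ _ _ _ _ (fun i s0 => I (A i) s0)).
- by rewrite writes_nest inE negb_or rrb.
- by rewrite writes_nest mem_cat negb_or rbrs.
- by rewrite srb.
- by apply: Ioff I0 _; apply: same_off_upd; rewrite inE eqxx.
- rewrite srb writes_nest => i s0 lt s0r f0 Ii.
  have s0rb : s0 rb = n.
    by rewrite f0 // inE negb_or eq_sym rrb mem_cat negb_or rbrs.
  apply: (IH (fun l s1 => I (A i ++ map (cons i) l) s1)) => //.
  + by move=> l s1 s2 Il f; apply: Ioff Il _; apply: same_off_sub f => x; rewrite inE orbC => ->.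
  + move=> l t l' s1 E s1t f1 Il; have [l2 E2] := tuples_split lt E.
    apply: W_mono (body _ _ _ s1 E2 _ _ Il) => [s2||].
    * by rewrite map_rcons -rcons_cat.
    * by rewrite /= s1t f1 ?s0r.
    * apply: same_off_trans f0 _; apply: same_off_sub f1 => x xl.
      by rewrite inE xl orbT.
  + by rewrite cats0.
  + move=> s1 f1 Is1; apply: (Ioff _ s1).
      suff -> : A i.+1 = A i ++ map (cons i) (tuples (size rs) n) by [].
      by rewrite /A -addn1 iotaD allpairs_cat /= cats0.
    by apply: same_off_upd; rewrite inE eqxx.
by rewrite srb writes_nest => s' _ f Is'; apply: IQ.
Qed.

Lemma size_tuples m n : size (tuples m n) = n ^ m.
Proof. by elim: m => //= m IH; rewrite size_allpairs size_iota IH expnS. Qed.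

Lemma mem_tuples m n v : (v \in tuples m n) = (size v == m) && all (fun i => i < n) v.
Proof.
elim: m v => [|m IH] [|i v] //=; first by apply/negP => /allpairsP[[? ?] []].
rewrite eqSS; apply/allpairsP/idP => [[[j u] /= [jn uT [-> ->]]]|/and3P[sz lt al]].
  by move: uT jn; rewrite IH mem_iota add0n => /andP[-> ->] /= ->.
by exists (i, v); rewrite /= mem_iota IH sz al lt.
Qed.

Lemma uniq_tuples m n : uniq (tuples m n).
Proof.
elim: m => //= m IH; apply: allpairs_uniq => //; first exact: iota_uniq.
by move=> [i v] [j u] _ _ /= [-> ->].
Qed.

Definition wseq b c1 c2 Q s : W w b (Seq c1 c2) Q s = W w b c1 (W w b c2 Q) s := erefl.
Definition wskip b Q s : W w b Skip Q s = Q s := erefl.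
Definition wfail b Q s : W w b Fail Q s = b := erefl.
Definition winc b r Q s : W w b (Inc r) Q s = Q (upd s r (s r).+1) := erefl.
Definition wcopy b r r' Q s : W w b (Copy r r') Q s = Q (upd s r (s r')) := erefl.
Definition wreset b Q s : W w b HReset Q s = Q (upd s HD 0) := erefl.
Definition wright b Q s :
  W w b HRight Q s = Q (upd s HD (minn (s HD).+1 L)) := erefl.
Definition wifeq b r r' c1 c2 Q s :
  W w b (IfEq r r' c1 c2) Q s = if s r == s r' then W w b c1 Q s else W w b c2 Q s := erefl.
Definition wifscan b p c1 c2 Q s :
  W w b (IfScan p c1 c2) Q s =
    if p (scan w (s HD)) then W w b c1 Q s else W w b c2 Q s := erefl.
Lemma updE s r v x : upd s r v x = if x == r then v else s x. Proof. by []. Qed.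

Definition rest (s : store) := drop (s HD).-1 w.

Lemma scan_rest s : 0 < s HD ->
  scan w (s HD) = if rest s is a :: _ then Letter a else RightEnd.
Proof.
rewrite /rest => h0; case E: (drop _ _) => [|a tl].
  case: (s HD) h0 E => //= h _ E; rewrite nth_default // size_map.
  by have := size_drop h w; rewrite E /=; lia.
by have [] := scan_letter h0 E.
Qed.

Lemma rest_right s s' : 0 < s HD -> s' HD = minn (s HD).+1 L ->
  0 < s' HD /\ rest s' = behead (rest s).
Proof.
rewrite /rest => h0 ->; split; first by lia.
rewrite -drop1 drop_drop add1n prednK //; have [le|le] := ltnP (s HD).+1 L.
  by [].
by rewrite /= drop_size drop_oversize.
Qed.

Definition letterp (p : pred letter) (sc : scanned letter) : bool :=
  if sc is Letter a then p a else false.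

Definition skipto p c cnt t :=
  Seq (Copy c ZR) (For t LEN (IfEq c cnt Skip (Seq (IfScan (letterp p) (Inc c) Skip) HRight))).

Lemma W_skipto b p c cnt t s :
  uniq [:: HD; LEN; ZR; c; cnt; t] -> s ZR = 0 -> s LEN = L -> 0 < s HD ->
  W w b (skipto p c cnt t)
    (fun s' => 0 < s' HD /\ rest s' = skipf p (s cnt) (rest s)) s.
Proof.
move=> U z0 sL h0; rewrite /skipto wseq wcopy z0; move: U.
rewrite /= !inE !negb_or => /and5P[/and5P[_ _ Hc Hn Ht] /and4P[_ Lc Ln Lt] _ /andP[cn ct] /andP[nt _]].
pose s1 := upd s c 0.
(* The last clause measures progress: each round consumes a letter unless the count or the end of
   the input is reached, and |w| + 1 rounds exceed the number of letters. *)
pose I i (s0 : store) := [/\ 0 < s0 HD, s0 c <= s cnt,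
  skipf p (s cnt - s0 c) (rest s0) = skipf p (s cnt) (rest s) &
  [|| s0 c == s cnt, size (rest s0) + i <= size w | nilp (rest s0)]].
apply: (@W_for _ _ _ _ _ I).
- by rewrite /= !inE !negb_or ?(eq_sym t) Lt ct Ht.
- by rewrite /= !inE !negb_or Lc.
- by rewrite updE (negPf Lc) sL.
- rewrite /I /rest !updE (negPf Ht) (negPf Hc) (negPf ct) eqxx subn0; split=> //.
  by rewrite addn0 size_drop leq_subr orbT.
- move=> i s0 _ s0t f0 [h0' le E fin].
  have nE : s0 cnt = s cnt.
    rewrite f0 ?updE; last by rewrite /= !inE !negb_or nt (eq_sym cnt c) cn (eq_sym cnt HD) Hn.
    by rewrite eq_sym (negPf cn).
  have It s' i' : I i' s' -> I i' (upd s' t i').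
    by rewrite /I /rest !updE (negPf Ht) (negPf ct).
  rewrite wifeq nE; case: eqP => [cE|/eqP cNE].
    by rewrite wskip; apply: It; split=> //; rewrite cE eqxx.
  have lt : s0 c < s cnt by rewrite ltn_neqAle cNE.
  rewrite wseq wifscan scan_rest //.
  have cr x : I i.+1 (upd (upd s0 c x) HD (minn (upd s0 c x HD).+1 L)) ->
      W w b HRight (fun s1 => I i.+1 (upd s1 t i.+1)) (upd s0 c x).
    by rewrite wright => ?; apply: It.
  have idc : I i.+1 (upd (upd s0 c (s0 c)) HD (minn (upd s0 c (s0 c) HD).+1 L)) ->
      W w b HRight (fun s1 => I i.+1 (upd s1 t i.+1)) s0.
    rewrite wright => H; apply: It; move: H; rewrite /I /rest !updE !eqxx (negPf Hc).
    by rewrite (eq_sym c) (negPf Hc).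
  have Istep x : x <= s cnt -> skipf p (s cnt - x) (behead (rest s0)) = skipf p (s cnt) (rest s) ->
      I i.+1 (upd (upd s0 c x) HD (minn (upd s0 c x HD).+1 L)).
    move=> xle xE; set s2 := upd _ _ _.
    have [h2 r2] : 0 < s2 HD /\ rest s2 = behead (rest s0).
      by apply: rest_right => //; rewrite /s2 !updE eqxx (negPf Hc).
    have c2 : s2 c = x by rewrite /s2 !updE (eq_sym c) (negPf Hc) eqxx.
    split=> //; rewrite ?c2 ?r2 //.
    move: fin; rewrite (negPf cNE) /= => /orP[|/nilP->]; last by rewrite !orbT.
    by case: (rest s0) => [|a tl] /=; rewrite ?orbT // addSnnS => ->; rewrite orbT.
  have mE : s cnt - s0 c = (s cnt - (s0 c).+1).+1 by lia.
  move: E Istep; rewrite mE; case: (rest s0) => [|a tl] /= E Istep.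
    rewrite wskip; apply: idc; apply: Istep => //.
    by rewrite -E; case: (s cnt - s0 c).
  case: ifP => pa; rewrite ?winc ?wskip.
    by apply: cr; apply: Istep => //; rewrite -E pa.
  by apply: idc; apply: Istep => //; rewrite -E pa mE.
move=> s' _ _; rewrite updE (negPf Lc) sL => -[h0' le E /or3P[/eqP cE||/nilP rE]].
- by split=> //; rewrite -E cE subnn skipf0.
- by lia.
- by split=> //; rewrite -E rE; case: (s cnt - s' c).
Qed.

End Rules.

(* [RU] is the start quadruple, [RV] and [RW] are vertices being enumerated, [RX] is
   the end of the guessed path, [RP] and [RE] serve as counters up to n^4, and
   [RCOUNT] is the number of vertices reachable in at most [RD] steps. *)
Notation RONE := 3 (only parsing).
Notation RNN := 4 (only parsing).
Notation RKK := 5 (only parsing).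
Notation RT := 6 (only parsing).
Notation RC := 7 (only parsing).
Notation RJ := 8 (only parsing).
Notation RA := 9 (only parsing).
Notation RY := 10 (only parsing).
Notation RY1 := 11 (only parsing).
Notation RX := [:: 12; 13; 14; 15] (only parsing).
Notation RU := [:: 16; 17; 18; 19] (only parsing).
Notation RV := [:: 20; 21; 22; 23] (only parsing).
Notation RW := [:: 24; 25; 26; 27] (only parsing).
Notation RP := [:: 28; 29; 30; 31] (only parsing).
Notation RE := [:: 32; 33; 34; 35] (only parsing).
Notation RD := 36 (only parsing).
Notation RCNT := 37 (only parsing).
Notation RCOUNT := 38 (only parsing).
Notation RNEWC := 39 (only parsing).
Notation RFND := 40 (only parsing).
Notation RC1 := 41 (only parsing).

(** Copying the running counter or not is a free choice in every round, so each value below the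
    bound is possible; the last copy counts, and without one the value is 0. *)
Definition guess r bnd := Seq (Copy r ZR) (For RT bnd (Choice Skip (Copy r RT))).

(** The table entry is guessed and confirmed by the match. [RY1] is needed because the word counts
    points from 1. *)
Definition lookup :=
  Seq HReset (Seq HRight (Seq (skipto is_semi RC RJ RT) (Seq (skipto is_comma RC RA RT)
    (Seq (guess RY RNN) (Seq (Copy RY1 RY) (Seq (Inc RY1) (MatchA RY1))))))).

Definition step1 r := Seq (Copy RA r) (Seq lookup (Copy r RY)).
Definition stepX := Seq (step1 12) (Seq (step1 13) (Seq (step1 14) (step1 15))).

Lemma encI_row k n tb j : valid k n tb -> j < k ->
  exists2 t, encI (drop j tb) = encT (nth [::] tb j) ++ t & table_ok n (nth [::] tb j).
Proof.
move=> [_ _ sz al] jk; rewrite (drop_nth [::]) ?sz //; exists (encI (drop j.+1 tb)) => //.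
by apply: (allP al); apply: mem_nth; rewrite sz.
Qed.

Section Guess.
Variable w : seq letter.
Notation L := (size w).+1.

(** For [b = false] the value to be guessed is [v]; for [b = true] it witnesses that the bound is
    positive, without which 0 would not be below it. *)
Lemma W_guess (b : bool) r bnd v s :
  uniq [:: ZR; r; RT; bnd] -> s ZR = 0 -> v < s bnd -> s bnd <= L ->
  W w b (guess r bnd) (fun s' => if b then is_true (s' r < s bnd) else s' r = v) s.
Proof.
rewrite /= !inE !negb_or => /and4P[/and3P[zr zt zb] /andP[rt rb] tb _] z0 lt le.
rewrite /guess wseq wcopy z0.
(* The successful run copies in round [v] only; until then the register is 0. *)
pose I i (s0 : store) := if b then is_true (s0 r < s bnd) else s0 r = (if i <= v then 0 else v).
have sb : upd s r 0 bnd = s bnd by rewrite updE eq_sym (negPf rb).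
apply: (@W_for _ _ _ _ _ I); rewrite ?sb //.
- by rewrite /= !inE (negPf tb) eq_sym (negPf rt).
- by rewrite /= !inE eq_sym (negPf rb).
- by rewrite /I !updE (negPf rt) eqxx leq0n; case: (b) => //; lia.
- move=> i s0 ib s0t _; rewrite /I; have : s0 RT = i by [].
  have c1 x : upd s0 RT x r = s0 r by rewrite updE (negPf rt).
  have c2 x y : upd (upd s0 r y) RT x r = y by rewrite !updE (negPf rt) eqxx.
  rewrite /W -/W; case: (b) => E Ir; first by rewrite c1 c2 E.
  rewrite c1 c2 Ir E; case: (ltngtP i v) => iv.
  + by left.
  + by left.
  + by right.
- by move=> s' _ _; rewrite /I; case: (b) => // ->; rewrite leqNgt lt.
Qed.
End Guess.

Section Tables.
Variables (w : seq letter) (k n : nat) (tb : seq (seq nat)).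
Notation L := (size w).+1.
Hypotheses (tbP : valid k n tb) (wE : w = encI tb) (kL : k <= L) (nL : n <= L).

Definition act j i : nat := nth 0 (nth [::] tb j) i.
Definition move_all j (v : seq nat) : seq nat := map (act j) v.

Lemma act_lt j i : j < k -> i < n -> act j i < n.
Proof.
move=> jk iN; have [_ _ /andP[/eqP sz al]] := encI_row tbP jk.
by apply: (allP al); apply: mem_nth; rewrite sz.
Qed.

Definition base (s : store) :=
  [/\ s LEN = L, s ZR = 0, s RONE = 1, s RNN = n & s RKK = k].

Lemma base_off l s s' : same_off l s s' ->
  all (fun r => r \notin l) [:: LEN; ZR; RONE; RNN; RKK] -> base s -> base s'.
Proof.
by move=> f /= /and5P[l1 l2 l3 l4 /andP[l5 _]] [? ? ? ? ?]; split; rewrite f.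
Qed.

Lemma W_lookup b s : base s -> s RJ < k -> s RA < n ->
  W w b lookup (fun s' => s' RY = act (s RJ) (s RA)) s.
Proof.
move=> bs jk an; have [t E1 /andP[/eqP szy aly]] := encI_row tbP jk.
have [_ _ szt _] := tbP.
rewrite /lookup wseq wreset wseq wright; set s2 := upd _ HD _.
have f2 : same_off [:: HD] s s2.
  by apply: same_off_trans; apply: same_off_upd; rewrite inE.
have h2 : s2 HD = 1 by rewrite /s2 updE /= updE /=; lia.
have r2 : rest w s2 = w by rewrite /rest h2 drop0.
have [b1 b2 b3 b4 b5] := base_off f2 isT bs.
rewrite wseq; apply: W_spec (W_skipto _ _ _ _ _ _) _; rewrite ?h2 //.
move=> s3 [h3 r3] f3; rewrite r2 (f2 RJ) // [X in skipf _ _ X]wE skip_semis ?szt 1?ltnW // E1 in r3.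
rewrite wseq; apply: W_spec (W_skipto _ _ _ _ _ _) _; rewrite ?(f3 LEN) ?(f3 ZR) ?(f3 RA) //.
rewrite (f2 RA) // => s4 [h4]; rewrite r3 skip_commas ?szy 1?ltnW //.
rewrite (drop_nth 0) ?szy // -/(act _ _) /= => r4 f4.
set y := act _ _ in r4 *; have yn : y < n by exact: act_lt.
have r4' : exists t', rest w s4 = map Bit (binary y.+1) ++ Comma :: t'.
  by rewrite r4 /encP -!catA cat_rcons; eexists; reflexivity.
case: r4' => t' {}r4.
have b44 : s4 RNN = n by rewrite f4 // f3.
rewrite wseq; apply: W_spec (W_guess (v := y) _ _ _ _ _) _; rewrite ?b44 //.
  by rewrite f4 // f3.
move=> s5 y5 f5; rewrite wseq wcopy wseq winc; set s6 := upd (upd _ _ _) _ _.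
have h6 : s6 HD = s4 HD by rewrite /s6 !updE /= f5.
have y6 : s6 RY1 = (s5 RY).+1 by rewrite /s6 !updE /=.
have s6y : s6 RY = s5 RY by rewrite /s6 !updE /=.
rewrite /W h6 y6; case: (b) y5 => y5.
  by move=> ds /(block_atE _ r4)[] // _ []; rewrite updE /= s6y.
exists (binary y.+1); last by rewrite updE /= s6y.
by rewrite y5; apply: block_at_binary r4.
Qed.

Lemma W_step1 b r s : base s -> s RJ < k -> s r < n -> RY1 < r ->
  W w b (step1 r) (fun s' => s' r = act (s RJ) (s r)) s.
Proof.
move=> bs jk rn r9; rewrite /step1 wseq wcopy wseq.
set s1 := upd _ _ _.
have f1 : same_off [:: RA] s s1 by apply: same_off_upd; rewrite inE.
apply: W_spec (W_lookup _ (base_off f1 isT bs) _ _) _; rewrite ?(f1 RJ) //.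
by move=> s2 y2 _; rewrite wcopy updE eqxx y2.
Qed.

Lemma W_stepX b s : base s -> s RJ < k -> all (fun i => i < n) (map s RX) ->
  W w b stepX (fun s' => map s' RX = move_all (s RJ) (map s RX)) s.
Proof.
move=> bs jk /= /and5P[x1 x2 x3 x4 _]; rewrite /stepX.
rewrite wseq; apply: W_spec (W_step1 _ bs jk x1 _) _ => // s1 y1 f1.
have b1 := base_off f1 isT bs.
rewrite wseq; apply: W_spec (W_step1 _ b1 _ _ _) _; rewrite ?f1 // => s2 y2 f2.
have b2 := base_off f2 isT b1.
rewrite wseq; apply: W_spec (W_step1 _ b2 _ _ _) _; rewrite ?f2 ?f1 // => s3 y3 f3.
have b3 := base_off f3 isT b2.
apply: W_spec (W_step1 _ b3 _ _ _) _; rewrite ?f3 ?f2 ?f1 // => s4 y4 f4.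
rewrite /= y4 !(f4 12, f4 13, f4 14) // y3 !(f3 12, f3 13, f3 8, f3 15) //.
by rewrite y2 !(f2 12, f2 8, f2 14, f2 15) // y1 ?(f1 8, f1 13, f1 14, f1 15).
Qed.

End Tables.

(** * Inductive counting *)

Fixpoint copies (rs rs' : seq nat) : cmd :=
  match rs, rs' with
  | r :: rs, r' :: rs' => Seq (Copy r r') (copies rs rs')
  | _, _ => Skip
  end.

Fixpoint ifeqs (rs rs' : seq nat) (c1 c2 : cmd) : cmd :=
  match rs, rs' with
  | r :: rs, r' :: rs' => IfEq r r' (ifeqs rs rs' c1 c2) c2
  | _, _ => c1
  end.

(** The counters [RP] only provide n^4 rounds, enough for every distance in question; idle rounds
    account for shorter paths. *)
Definition path_cmd :=
  Seq (copies RX RU) (Seq (Copy RC1 ZR)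
    (nest RP RNN (Choice Skip (IfEq RC1 RD Skip
      (Seq (guess RJ RKK) (Seq stepX (Inc RC1))))))).

Definition setf := Copy RFND RONE.

Definition test_cmd (fin : bool) :=
  if fin then ifeqs [:: 24; 25; 26] [:: 18; 19; 27] setf Skip
  else Seq (ifeqs RW RV setf Skip)
         (For RJ RKK (Seq (copies RX RW) (Seq stepX (ifeqs RX RV setf Skip)))).

(* Decides whether the test holds for some vertex reachable in at most [RD] steps;
   a run that misses one of these vertices fails in the end. *)
Definition check_cmd (fin : bool) :=
  Seq (Copy RCNT ZR) (Seq (Copy RFND ZR) (Seq
    (nest RW RNN (Choice Skip
      (Seq path_cmd (ifeqs RX RW (Seq (Inc RCNT) (test_cmd fin)) Fail))))
    (IfEq RCNT RCOUNT Skip Fail))).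

(** The rounds over [RE] raise the distance to n^4, where nothing new can be reached. Failing when
    the final test succeeds decides the complement. *)
Definition count_cmd :=
  Seq (Copy RCOUNT RONE) (Seq (Copy RD ZR) (Seq
    (nest RE RNN (Seq (Copy RNEWC ZR) (Seq
      (nest RV RNN (Seq (check_cmd false) (IfEq RFND RONE (Inc RNEWC) Skip)))
      (Seq (Copy RCOUNT RNEWC) (Inc RD)))))
    (Seq (check_cmd true) (IfEq RFND RONE Fail Skip)))).

Section Lists.
Variable w : seq letter.

Lemma writes_copies rs rs' : size rs = size rs' -> writes (copies rs rs') = rs.
Proof. by elim: rs rs' => [|r rs IH] [|r' rs'] //= [] /IH->. Qed.

Lemma W_copies b rs rs' s :
  size rs = size rs' -> uniq rs -> all (fun r => r \notin rs) rs' ->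
  W w b (copies rs rs') (fun s' => map s' rs = map s rs') s.
Proof.
elim: rs rs' s => [|r rs IH] [|r' rs'] s //= [sz] /andP[rrs u] /andP[_ al].
have al1 : all (fun x => x \notin rs) rs'.
  by apply: sub_all al => x; rewrite inE negb_or => /andP[].
rewrite wseq wcopy; apply: W_spec (IH _ _ sz u al1) _ => s1 E f1.
rewrite E f1 ?writes_copies // updE eqxx; congr (_ :: _).
apply: (@same_off_map [:: r]); first by apply: same_off_upd; rewrite inE.
by apply: sub_all al => x; rewrite !inE negb_or => /andP[].
Qed.

Lemma W_ifeqs b rs rs' c1 c2 Q s : size rs = size rs' ->
  W w b (ifeqs rs rs' c1 c2) Q s =
  if map s rs == map s rs' then W w b c1 Q s else W w b c2 Q s.
Proof.
elim: rs rs' => [|r rs IH] [|r' rs'] //= [/IH E].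
by rewrite wifeq E eqseq_cons; case: (s r == s r').
Qed.

Lemma wchoice b c1 c2 Q s : W w b (Choice c1 c2) Q s =
  if b then W w b c1 Q s /\ W w b c2 Q s else W w b c1 Q s \/ W w b c2 Q s.
Proof. by []. Qed.

End Lists.

Section Counting.
Variables (w : seq letter) (k n : nat) (tb : seq (seq nat)).
Notation L := (size w).+1.
Hypotheses (tbP : valid k n tb) (wE : w = encI tb) (kL : k <= L) (nL : n <= L).
Notation V := (tuples 4 n).
Notation act_all := (move_all tb).
Notation base := (base w k n).

(** Reflexive, so that [d] edges express distance at most [d] and the counted sets increase. *)
Definition edge (x v : seq nat) := (x == v) || has (fun j => act_all j x == v) (iota 0 k).

Variable u : seq nat.
Hypothesis uV : u \in V.

Fixpoint rch d (v : seq nat) : bool :=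
  if d is d'.+1 then has (fun x => rch d' x && edge x v) V else v == u.

Lemma act_all_V j x : j < k -> x \in V -> act_all j x \in V.
Proof.
rewrite !mem_tuples => jk /andP[sz al]; rewrite size_map sz all_map.
by apply: sub_all al => i; exact: (act_lt tbP).
Qed.

Lemma rch_V d v : rch d v -> v \in V.
Proof.
elim: d v => [|d IH] v /=; first by move/eqP->.
case/hasP=> x xV /andP[_ /orP[/eqP<-//|/hasP[j]]].
by rewrite mem_iota => jk /eqP<-; apply: act_all_V.
Qed.

Lemma rch_step d x j : rch d x -> j < k -> rch d.+1 (act_all j x).
Proof.
move=> rx jk; apply/hasP; exists x; first exact: rch_V rx.
apply/andP; split=> //; apply/orP; right; apply/hasP; exists j => //.
by rewrite mem_iota.
Qed.

Lemma rch_leq d d' x : d <= d' -> rch d x -> rch d' x.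
Proof.
move=> le rx; rewrite -(subnK le); elim: (d' - d) => //= i IH.
by apply/hasP; exists x; [exact: rch_V rx|rewrite IH /edge eqxx].
Qed.

Lemma rch_word d v : rch d v ->
  exists js, [/\ size js <= d, all (fun j => j < k) js &
                 foldl (fun x j => act_all j x) u js = v].
Proof.
elim: d v => [|d IH] v /=; first by move/eqP->; exists [::].
case/hasP=> x _ /andP[/IH[js [sz al E]]] /orP[/eqP<-|/hasP[j]].
  by exists js; split=> //; rewrite leqW.
rewrite mem_iota => jk /eqP<-; exists (rcons js j).
by rewrite size_rcons all_rcons al foldl_rcons E; split=> //; apply/andP.
Qed.

Definition ready s := base s /\ map s RU = u.

Lemma ready_off l s s' : same_off l s s' ->
  all (fun r => r \notin l) ([:: LEN; ZR; RONE; RNN; RKK] ++ RU) -> ready s -> ready s'.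
Proof.
move=> f; rewrite all_cat => /andP[h1 h2] [bs us]; split; first exact: base_off f h1 bs.
by rewrite (same_off_map f h2).
Qed.

Lemma W_path_true s : ready s ->
  W w true path_cmd (fun s' => rch (s RD) (map s' RX)) s.
Proof.
move=> rs; have [bs us] := rs; rewrite /path_cmd wseq.
apply: W_spec (W_copies _ _ _ _ _ _) _ => // s1 x1 f1.
have r1 := ready_off f1 isT rs; rewrite wseq wcopy; set s2 := upd _ _ _.
have f2 : same_off [:: RC1] s1 s2 by apply: same_off_upd; rewrite inE.
have r2 := ready_off f2 isT r1.
have [[_ _ _ n2 k2] _] := r2.
pose I (l : seq (seq nat)) (s0 : store) :=
  rch (s0 RC1) (map s0 RX) /\ s0 RC1 <= s RD.
apply: (@W_nest _ _ _ _ _ _ I); rewrite ?n2 //.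
- by move=> l s3 s4 [h1 h2] f; rewrite /I (same_off_map f) // !f.
- move=> l t l' s0 _ _ f0 [h1 h2]; rewrite wchoice; split=> //.
  have r0 := ready_off f0 isT r2; have [[_ z0 _ n0 k0] _] := r0.
  rewrite wifeq; have d0 : s0 RD = s RD by rewrite f0 // f2 // f1.
  case: eqP => // /eqP ne; rewrite d0 in ne.
  have [kpos _ _ _] := tbP.
  rewrite wseq; apply: W_spec (W_guess (v := 0) _ _ _ _ _) _; rewrite ?k0 //.
  move=> s3 j3 f3; have r3 := ready_off f3 isT r0.
  have xE : map s3 RX = map s0 RX by rewrite (same_off_map f3).
  rewrite wseq; apply: W_spec (W_stepX tbP wE kL nL _ r3.1 j3 _) _.
    by rewrite xE; move: (rch_V h1); rewrite mem_tuples => /andP[].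
  move=> s4 x4 f4; rewrite winc.
  have c4 : s4 RC1 = s0 RC1 by rewrite f4 // f3.
  split; rewrite updE /= c4; last by rewrite ltn_neqAle ne.
  by have := rch_step h1 j3; rewrite -xE -x4.
- have [[_ z1 _ _ _] _] := r1.
  have c2 : s2 RC1 = 0 by rewrite /s2 updE eqxx.
  by rewrite /I c2 (same_off_map f2) // x1 us /= eqxx.
- move=> s' f [h1 h2].
  exact: rch_leq h2 h1.
Qed.

Lemma W_path_false s v : ready s -> rch (s RD) v -> s RD <= n ^ 4 ->
  W w false path_cmd (fun s' => map s' RX = v) s.
Proof.
move=> rs /rch_word[js [sz al jsE]] dn; have [bs us] := rs; rewrite /path_cmd wseq.
apply: W_spec (W_copies _ _ _ _ _ _) _ => // s1 x1 f1.
have r1 := ready_off f1 isT rs; rewrite wseq wcopy; set s2 := upd _ _ _.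
have f2 : same_off [:: RC1] s1 s2 by apply: same_off_upd; rewrite inE.
have r2 := ready_off f2 isT r1.
have [[_ _ _ n2 k2] _] := r2.
(* This run follows [js] in the first [size js] rounds and idles afterwards. *)
pose I (l : seq (seq nat)) (s0 : store) :=
  s0 RC1 = minn (size l) (size js) /\
  map s0 RX = foldl (fun x j => act_all j x) u (take (s0 RC1) js).
have rchI i : rch i (foldl (fun x j => act_all j x) u (take i js)).
  elim: i => [|i IH]; first by rewrite take0 /=.
  case: (ltnP i (size js)) => lt; last first.
    by move: IH; rewrite !take_oversize ?leqW //; apply: rch_leq.
  rewrite (take_nth 0) // foldl_rcons; apply: rch_step => //.
  by apply: (allP al); apply: mem_nth.
apply: (@W_nest _ _ _ _ _ _ I); rewrite ?n2 //.
- by move=> l s3 s4 [h1 h2] f; rewrite /I (same_off_map f) // !f.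
- move=> l t l' s0 _ _ f0 [h1 h2]; rewrite wchoice /I size_rcons.
  case: (ltnP (size l) (size js)) => lt; last first.
    by left; rewrite wskip h1 h2 h1 !(minn_idPr _) // leqW.
  right; rewrite (minn_idPl (ltnW lt)) in h1.
  have r0 := ready_off f0 isT r2; have [[_ z0 _ n0 k0] _] := r0.
  rewrite wifeq; have d0 : s0 RD = s RD by rewrite f0 // f2 // f1.
  have -> : (s0 RC1 == s0 RD) = false.
    by apply/negbTE; rewrite neq_ltn d0 h1 (leq_trans lt).
  have jk : nth 0 js (size l) < k by apply: (allP al); apply: mem_nth.
  rewrite wseq; apply: W_spec (W_guess (v := nth 0 js (size l)) _ _ _ _ _) _; rewrite ?k0 //.
  move=> s3 j3 f3; have r3 := ready_off f3 isT r0.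
  have xE : map s3 RX = map s0 RX by rewrite (same_off_map f3).
  rewrite wseq; apply: W_spec (W_stepX tbP wE kL nL _ r3.1 _ _) _; rewrite ?j3 //.
    by rewrite xE h2; move: (rch_V (rchI (s0 RC1))); rewrite mem_tuples => /andP[].
  move=> s4 x4 f4; rewrite winc.
  have c4 : s4 RC1 = s0 RC1 by rewrite f4 // f3.
  have f5 : same_off [:: RC1] s4 (upd s4 RC1 (s4 RC1).+1).
    by apply: same_off_upd; rewrite inE.
  have -> : upd s4 RC1 (s4 RC1).+1 RC1 = (size l).+1 by rewrite updE eqxx c4 h1.
  rewrite (minn_idPl lt) (same_off_map f5) // x4 xE h2 h1.
  by rewrite (take_nth 0) // foldl_rcons.
- have [[_ z1 _ _ _] _] := r1.
  have c2 : s2 RC1 = 0 by rewrite /s2 updE eqxx.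
  by rewrite /I c2 (same_off_map f2) // x1 us min0n take0.
- move=> s' f [h1 h2]; rewrite h2 h1 (size_tuples 4) (minn_idPr _) ?take_size //.
  exact: leq_trans dn.
Qed.

(* For [u] = (p, q, r, s) the final test is [x] = (r, s, t, t). *)
Definition tst (fin : bool) (v x : seq nat) : bool :=
  if fin then [:: nth 0 x 0; nth 0 x 1; nth 0 x 2] == [:: nth 0 u 2; nth 0 u 3; nth 0 x 3]
  else edge x v.

Lemma W_test b fin s v x : ready s -> map s RV = v -> map s RW = x -> x \in V ->
  W w b (test_cmd fin) (fun s' => s' RFND = if tst fin v x then 1 else s RFND) s.
Proof.
move=> rs vE xE xV; have [[_ z0 o0 n0 k0] us] := rs.
have setE c1 s0 : s0 RONE = 1 ->
    (if c1 : bool then W w b setf (fun s' => s' RFND = if c1 then 1 else s0 RFND) s0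
     else W w b Skip (fun s' => s' RFND = if c1 then 1 else s0 RFND) s0).
  by move=> o1; case: c1; rewrite ?wcopy ?wskip ?updE.
case: fin; rewrite /test_cmd /tst.
  rewrite W_ifeqs // -us -xE /=; exact: setE.
rewrite wseq W_ifeqs // vE xE /edge.
suff gen s1 : same_off [:: RFND] s s1 ->
    s1 RFND = (if x == v then 1 else s RFND) ->
    W w b (For RJ RKK (Seq (copies RX RW) (Seq stepX (ifeqs RX RV setf Skip))))
      (fun s' => s' RFND = (if (x == v) || has (fun j => act_all j x == v) (iota 0 k)
                            then 1 else s RFND)) s1.
  case: ifP => xv; rewrite ?wskip ?wcopy; apply: gen; rewrite ?xv //.
    by apply: same_off_upd; rewrite inE.
move=> f1 E1; have r1 := ready_off f1 isT rs; have [[l1 _ _ _ k1] _] := r1.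
apply: (@W_for _ _ _ _ _ (fun i s0 => s0 RFND =
    if (x == v) || has (fun j => act_all j x == v) (iota 0 i) then 1 else s RFND));
  rewrite ?k1 //.
- by rewrite updE /= orbF.
- move=> i s0 ik s0j f0 E0; have r0 := ready_off f0 isT r1.
  rewrite wseq; apply: W_spec (W_copies _ _ _ _ _ _) _ => // s2 x2 f2.
  have r2 := ready_off f2 isT r0.
  have x0E : map s0 RW = x by rewrite (same_off_map f0) // (same_off_map f1).
  have v0E : map s0 RV = v by rewrite (same_off_map f0) // (same_off_map f1).
  rewrite wseq; apply: W_spec (W_stepX tbP wE kL nL _ r2.1 _ _) _; rewrite ?(f2 RJ) ?s0j //.
    by rewrite x2 x0E; move: xV; rewrite mem_tuples => /andP[].
  move=> s3 x3 f3; have r3 := ready_off f3 isT r2; have [[_ _ o3 _ _] _] := r3.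
  rewrite W_ifeqs // x3 x2 x0E (same_off_map f3) // (same_off_map f2) // v0E.
  have F3 : s3 RFND = s0 RFND by rewrite f3 // f2.
  have -> : iota 0 i.+1 = iota 0 i ++ [:: i] by rewrite -addn1 iotaD.
  rewrite has_cat /= orbF orbA.
  case: (act_all i x == v); first by rewrite orbT wcopy !updE.
  by rewrite orbF wskip updE /= F3.
Qed.

(** The enumeration can miss a reachable vertex, but it never counts an unreachable one and visits
    each only once. The counter is thus at most the true number, and a single miss leaves a deficit
    for good; equality at the end proves that the test was applied to all of them. *)
Lemma W_check b fin s v : ready s -> map s RV = v -> s RD <= n ^ 4 ->
  s RCOUNT = count (rch (s RD)) V ->
  W w b (check_cmd fin)
    (fun s' => s' RFND = has (fun x => rch (s RD) x && tst fin v x) V) s.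
Proof.
move=> rs vE dn cE; have [[_ z0 o0 n0 k0] us] := rs.
rewrite /check_cmd wseq wcopy wseq wcopy; set s2 := upd (upd _ _ _) _ _.
have f2 : same_off [:: RCNT; RFND] s s2.
  by apply: same_off_trans; apply: same_off_upd; rewrite !inE.
have r2 := ready_off f2 isT rs; have [[_ _ _ n2 _] _] := r2.
set d := s RD in dn cE *.
pose I (l : seq (seq nat)) (s0 : store) :=
  [/\ s0 RCNT <= count (rch d) l,
      s0 RCNT = count (rch d) l -> s0 RFND = has (fun x => rch d x && tst fin v x) l &
      b = false -> s0 RCNT = count (rch d) l].
rewrite wseq; apply: (@W_nest _ _ _ _ _ _ I); rewrite ?n2 //.
- by case: (fin).
- by case: (fin).
- by move=> l s3 s4 [h1 h2 h3] f; split; rewrite !f.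
- move=> l t l' s0 E tE f0 [h1 h2 h3].
  have tV : t \in V by rewrite E mem_cat inE eqxx orbT.
  have r0 : ready s0 by apply: ready_off f0 _ r2; case: (fin).
  have d0 : s0 RD = d by rewrite f0 ?f2 //; case: (fin).
  have v0E : map s0 RV = v.
    by rewrite (same_off_map f0) ?(same_off_map f2) //; case: (fin).
  have skip : (b = false -> ~~ rch d t) -> W w b Skip (I (rcons l t)) s0.
    rewrite wskip /I -cats1 count_cat has_cat /= addn0 orbF => bt.
    case: (rch d t) bt => bt /=; last by rewrite addn0 orbF.
    split; [by rewrite addn1 leqW | by move=> c; move: h1; rewrite c addn1 ltnn | by move/bt].
  have tail s1 : rch d t -> same_off (writes path_cmd) s0 s1 -> map s1 RX = t ->
      W w b (ifeqs RX RW (Seq (Inc RCNT) (test_cmd fin)) Fail) (I (rcons l t)) s1.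
    move=> rt f1 x1; rewrite W_ifeqs // x1 (same_off_map f1) // tE eqxx wseq winc.
    set s3 := upd _ _ _.
    have f3 : same_off [:: RCNT] s1 s3 by apply: same_off_upd; rewrite inE.
    have r3 : ready s3 by apply: ready_off f3 isT (ready_off f1 isT r0).
    apply: W_spec (@W_test b fin s3 v t r3 _ _ tV) _.
    + by rewrite (same_off_map f3) // (same_off_map f1).
    + by rewrite (same_off_map f3) // (same_off_map f1).
    move=> s4 F4 f4.
    have c4 : s4 RCNT = (s0 RCNT).+1.
      by rewrite f4; [rewrite /s3 updE eqxx f1|case: (fin)].
    rewrite /I -cats1 count_cat has_cat /= addn0 orbF rt c4 F4 f3 // f1 //=.
    split; first by rewrite addn1.
      by rewrite addn1 => -[/h2->]; case: tst; rewrite ?orbT ?orbF.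
    by move=> /h3->; rewrite addn1.
  rewrite wchoice; case: ifP => hb.
    split; first by apply: skip; rewrite hb.
    rewrite wseq hb; apply: W_spec (W_path_true r0) _; rewrite d0 => s1 rx f1.
    have [xt|xt] := eqVneq (map s1 RX) t.
      by rewrite -hb; apply: tail; rewrite -?xt.
    by rewrite W_ifeqs // (same_off_map f1 (rs := RW)) // tE (negPf xt) wfail.
  case: (boolP (rch d t)) => rt; last by left; apply: skip.
  right; rewrite wseq hb; apply: W_spec (W_path_false (v := t) r0 _ _) _; rewrite ?d0 //.
  by move=> s1 x1 f1; rewrite -hb; apply: tail.
- by split; rewrite /s2 !updE //= z0.
move=> s' f [h1 h2 h3]; rewrite wifeq.
have -> : s' RCOUNT = count (rch d) V.
  by rewrite f ?f2 //; case: (fin).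
case: eqP => [/h2 h|ne]; rewrite ?wskip ?wfail //.
by case: (b) h3 => // h3; case: ne; apply: h3.
Qed.

(** The final test concerns only [u] and [x], whence the placeholder [[::]]. *)
Definition bad : bool := has (fun x => rch (n ^ 4) x && tst true [::] x) V.

(** The postcondition speaks of the input and not of the store: a run that gets through is itself
    the certificate of non-reachability. *)
Lemma W_count b s : ready s -> (b = false -> ~~ bad) ->
  W w b count_cmd (fun _ => ~~ bad) s.
Proof.
move=> rs nb; have [[_ z0 o0 n0 k0] us] := rs.
rewrite /count_cmd wseq wcopy wseq wcopy; set s2 := upd (upd _ _ _) _ _.
have f2 : same_off [:: RCOUNT; RD] s s2.
  by apply: same_off_trans; apply: same_off_upd; rewrite !inE.
have r2 := ready_off f2 isT rs; have [[_ _ _ n2 _] _] := r2.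
pose I (l : seq (seq nat)) (s0 : store) :=
  s0 RD = size l /\ s0 RCOUNT = count (rch (size l)) V.
rewrite wseq; apply: (@W_nest _ _ _ _ _ _ I); rewrite ?n2 //.
- by move=> l s3 s4 [h1 h2] f; rewrite /I !f.
- move=> l t l' s0 E _ f0 [h1 h2]; have r0 := ready_off f0 isT r2.
  have ln : size l < n ^ 4.
    by rewrite -(size_tuples 4) E size_cat /= addnS ltnS leq_addr.
  rewrite wseq wcopy; set s3 := upd _ _ _.
  have f3 : same_off [:: RNEWC] s0 s3 by apply: same_off_upd; rewrite inE.
  have r3 := ready_off f3 isT r0; have [[_ z3 _ n3 _] _] := r3.
  pose I2 (l2 : seq (seq nat)) (s0 : store) := s0 RNEWC = count (rch (size l).+1) l2.
  rewrite wseq; apply: (@W_nest _ _ _ _ _ _ I2); rewrite ?n3 //.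
  + by move=> l2 s4 s5; rewrite /I2 => E2 f; rewrite f.
  + move=> l2 t2 l2' s4 E2 t4 f4 E4; have r4 := ready_off f4 isT r3.
    have d4 : s4 RD = size l by rewrite f4 // f3.
    have c4 : s4 RCOUNT = count (rch (s4 RD)) V by rewrite d4 f4 // f3.
    rewrite wseq; apply: W_spec (W_check _ false r4 t4 _ c4) _; first by rewrite d4 ltnW.
    move=> s5 F5 f5; have [[_ _ o5 _ _] _] := ready_off f5 isT r4.
    rewrite wifeq o5 F5 d4 /I2 -cats1 count_cat /= addn0 -E4 -(f5 RNEWC) //.
    by case: has; rewrite /= ?winc ?wskip ?updE ?eqxx ?addn1 ?addn0.
  move=> s5 f5; rewrite /I2 wseq wcopy winc /I => c5.
  have d5 : s5 RD = size l by rewrite (f5 RD) // (f3 RD).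
  by rewrite size_rcons !updE /= d5 c5.
- split; first exact: z0.
  have -> : s2 RCOUNT = 1 by exact: o0.
  by rewrite (eq_count (a2 := pred1 u)) ?count_uniq_mem ?(uniq_tuples 4) ?uV.
move=> s' f [h1 h2]; have r' := ready_off f isT r2.
have dE : s' RD = n ^ 4 by rewrite h1 (size_tuples 4).
rewrite h1 in dE; rewrite wseq.
apply: W_spec (W_check _ true r' erefl _ _) _; rewrite h1 ?dE //.
  by rewrite h2 dE.
move=> s5 F5 f5; have [[_ _ o5 _ _] _] := ready_off f5 isT r'.
have bE : has (fun x => rch (n ^ 4) x && tst true (map s' RV) x) V = bad by [].
rewrite wifeq o5 F5 bE; case: (bad) nb; rewrite ?wfail ?wskip //=.
by case: (b) => // /(_ erefl).
Qed.

End Counting.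

(** * The decision procedure *)

Definition read_point :=
  Seq (guess RY RNN) (Seq (Copy RY1 RY) (Seq (Inc RY1) (Seq (MatchA RY1) HRight))).

Definition read_table := Seq (For RA RNN read_point) (IfScan (letterp is_semi) HRight Fail).

Definition at_end (sc : scanned letter) := if sc is RightEnd then true else false.

(** Both numbers are guessed first and confirmed by the parse. They are below |w| + 1 because every
    entry and every table ends with its own separator. *)
Definition parse_cmd :=
  Seq (guess RNN LEN) (Seq (guess RKK LEN)
    (Seq (IfEq RNN ZR Fail Skip) (Seq (IfEq RKK ZR Fail Skip)
    (Seq HReset (Seq HRight (Seq (For RJ RKK read_table) (IfScan at_end Skip Fail))))))).

Definition main_cmd :=
  Seq (Inc RONE) (Seq parse_cmd (nest RU RNN (IfEq 18 19 Skip count_cmd))).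

(** The criterion on bare tables, which keeps the verification of the program free of semigroups. *)
Definition good (w : seq letter) : Prop :=
  exists k n tb, [/\ valid k n tb, w = encI tb &
    forall u, u \in tuples 4 n -> nth 0 u 2 != nth 0 u 3 -> ~~ bad k n tb u].

(** * Parsing the input *)

Section Parse.
Variable w : seq letter.
Notation L := (size w).+1.

Lemma drop_block h ds t : 0 < h -> drop h.-1 w = map Bit ds ++ Comma :: t ->
  drop (h + size ds).-1 w = Comma :: t.
Proof.
move=> h0 E; have -> : (h + size ds).-1 = size (map Bit ds) + h.-1.
  by rewrite size_map; lia.
by rewrite -drop_drop E drop_size_cat.
Qed.

Lemma W_right b s (Q : store -> Prop) : 0 < s HD ->
  (forall s', 0 < s' HD -> rest w s' = behead (rest w s) -> same_off [:: HD] s s' -> Q s') ->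
  W w b HRight Q s.
Proof.
move=> h0 H; rewrite wright; set s' := upd _ _ _.
have [h r] := @rest_right w s s' h0 erefl.
by apply: H => //; apply: same_off_upd; rewrite inE.
Qed.

Lemma W_read_point b n y t s : s ZR = 0 -> s RNN = n -> n <= L -> 0 < s HD -> y < n ->
  (b = false -> rest w s = encP y ++ t) ->
  W w b read_point (fun s' => 0 < s' HD /\
    exists y', [/\ y' < n, rest w s = encP y' ++ rest w s' &
                   b = false -> y' = y /\ rest w s' = t]) s.
Proof.
move=> z0 n0 nL h0 yn E; rewrite /read_point wseq.
apply: W_spec (W_guess (v := y) _ _ _ _ _) _; rewrite ?n0 //.
move=> s1 y1 f1; have h1 : s1 HD = s HD by rewrite f1.
rewrite wseq wcopy wseq winc wseq; set s2 := upd (upd _ _ _) _ _.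
have h2 : s2 HD = s HD by rewrite /s2 !updE /= h1.
have y2 : s2 RY1 = (s1 RY).+1 by [].
have fin ds t' : rest w s = map Bit ds ++ Comma :: t' ->
    W w b HRight (fun s' => 0 < s' HD /\ rest w s' = t') (upd s2 HD (s2 HD + size ds)).
  move=> Ed; apply: W_right => [|s' h' r' _]; first by rewrite updE h2 ltn_addr.
  by split=> //; rewrite r' /rest updE eqxx h2 (drop_block h0 Ed).
case: b y1 E fin => y1 E fin; rewrite [W _ _ (MatchA _)]/W -/W h2 y2.
  move=> ds [_ [t' Ed] ls bv]; rewrite -h2; apply: W_mono (fin _ _ Ed) => s' [h' r'].
  split=> //; exists (s1 RY); split=> //.
  by rewrite /encP -bv binary_bval // cat_rcons r'.
have Ed : rest w s = map Bit (binary y.+1) ++ Comma :: t.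
  by rewrite E // /encP cat_rcons.
exists (binary y.+1); first by rewrite y1; apply: block_at_binary Ed.
rewrite -h2; apply: W_mono (fin _ _ Ed) => s' [h' r'].
by split=> //; exists y; rewrite E // r'; split.
Qed.

Lemma size_encP y : 0 < size (encP y).
Proof. by rewrite size_rcons. Qed.

Lemma size_flatten_ge (T : Type) (f : T -> seq letter) l :
  (forall x, 0 < size (f x)) -> size l <= size (flatten (map f l)).
Proof.
move=> f0; elim: l => //= x l IH; rewrite size_cat.
by have := f0 x; lia.
Qed.

Lemma W_read_table b n ys t s : s ZR = 0 -> s RNN = n -> 0 < n <= L -> 0 < s HD ->
  (b = false -> table_ok n ys /\ rest w s = encT ys ++ t) ->
  W w b read_table (fun s' => 0 < s' HD /\
    exists ys', [/\ table_ok n ys', rest w s = encT ys' ++ rest w s' &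
                    b = false -> rest w s' = t]) s.
Proof.
move=> z0 n0 /andP[npos nL] h0 E; rewrite /read_table wseq.
pose I i (s0 : store) := 0 < s0 HD /\ exists ys', [/\ size ys' = i, all (fun y => y < n) ys',
   rest w s = flatten (map encP ys') ++ rest w s0 &
   b = false -> rest w s0 = flatten (map encP (drop i ys)) ++ Semicolon :: t].
apply: (@W_for _ _ _ _ _ I); rewrite ?n0 //.
- split=> //; exists [::]; split=> // hb; have [_ r] := E hb.
  by rewrite [LHS]r drop0 /encT cat_rcons.
- move=> i s0 lt _ f0 [h1 [ys' [sz al E1 E2]]].
  (* The successful run guesses the actual entry; when all runs are considered, any value below [n]
     can instantiate [W_guess]. *)
  pose y := if b then 0 else nth 0 ys i.
  have yn : y < n.
    rewrite /y; case: ifP => // /E[/andP[/eqP szy aly] _].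
    by apply: (allP aly); apply: mem_nth; rewrite szy.
  have n00 : s0 RNN = n by rewrite f0.
  apply: W_spec (@W_read_point b n y (flatten (map encP (drop i.+1 ys)) ++ Semicolon :: t)
     s0 _ n00 nL h1 yn _) _.
  + by rewrite f0.
  + move=> hb; rewrite E2 // (drop_nth 0) /= ?catA /y ?hb //.
    by have [/andP[/eqP-> _] _] := E hb.
  move=> s1 [h2 [y' [y'n E3 E4]]] _; split=> //.
  exists (rcons ys' y'); split=> //.
  + by rewrite size_rcons sz.
  + by rewrite all_rcons y'n.
  + by rewrite map_rcons -cats1 flatten_cat /= cats0 -catA E1 E3.
  + by move=> hb; have [_ r] := E4 hb; exact: r.
move=> s1 _ f1 [h1 [ys' [sz al E1 E2]]]; rewrite wifscan scan_rest //.
case E3: (rest w s1) => [|[b'||] tl] /=; rewrite ?wfail.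
1-3: by case: (b) E E2 => // /(_ erefl)[/andP[/eqP szy _] _] /(_ erefl); rewrite E3 -szy drop_size.
apply: W_right => // s2 h2 r2 _; split=> //; rewrite r2 E3 /=.
exists ys'; split.
- by rewrite /table_ok sz eqxx.
- by rewrite E1 E3 /encT cat_rcons.
- move=> hb; have := E2 hb; have [/andP[/eqP szy _] _] := E hb.
  by rewrite E3 -szy drop_size => -[].
Qed.

Lemma W_parse b k n tb s : s LEN = L -> s ZR = 0 -> s RONE = 1 ->
  (b = false -> [/\ valid k n tb, w = encI tb, k < L & n < L]) ->
  W w b parse_cmd (fun s' => exists k' n' tb', [/\ valid k' n' tb', w = encI tb',
     base w k' n' s', k' <= L /\ n' <= L &
     b = false -> [/\ k' = k, n' = n & tb' = tb]]) s.
Proof.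
move=> sL s0 s1 H; rewrite /parse_cmd wseq.
pose nv := if b then 0 else n; pose kv := if b then 0 else k.
have nvL : nv < L by rewrite /nv; case: ifP => // /H[].
have kvL : kv < L by rewrite /kv; case: ifP => // /H[].
apply: W_spec (W_guess (v := nv) _ _ _ _ _) _; rewrite ?sL // => s2 n2 f2.
rewrite wseq; apply: W_spec (W_guess (v := kv) _ _ _ _ _) _; rewrite ?f2 ?sL // => s3 k3 f3.
set n' := s2 RNN in n2; set k' := s3 RKK in k3.
have n'L : n' < L by move: n2 nvL; case: (b) => // ->.
have k'L : k' < L by move: k3 kvL; case: (b) => // ->.
have n'E : b = false -> n' = n by move=> hb; move: n2; rewrite /nv hb.
have k'E : b = false -> k' = k by move=> hb; move: k3; rewrite /kv hb.
have bs3 : base w k' n' s3 by split=> //; rewrite f3 // f2.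
have [_ z3 _ n3 _] := bs3.
rewrite wseq wifeq n3 z3 -/n'; case: eqP => [n'0|/eqP n'0].
  by rewrite wfail; case: (b) n'E H => // n'E [] // []; rewrite -n'E // n'0.
rewrite wskip wseq wifeq z3 -/k'; case: eqP => [k'0|/eqP k'0].
  by rewrite wfail; case: (b) k'E H => // k'E [] // []; rewrite -k'E // k'0.
rewrite wskip wseq wreset wseq wright; set s4 := upd _ _ _.
have f4 : same_off [:: HD] s3 s4.
  by apply: same_off_trans; apply: same_off_upd; rewrite inE.
have bs4 := base_off f4 isT bs3; have [l4 z4 o4 n4 k4] := bs4.
have h4 : s4 HD = 1 by rewrite /s4 updE /= updE /=; lia.
pose I j (s0 : store) := 0 < s0 HD /\ exists tb', [/\ size tb' = j, all (table_ok n') tb',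
   w = encI tb' ++ rest w s0 & b = false -> rest w s0 = encI (drop j tb)].
rewrite wseq; apply: (@W_for _ _ _ _ _ I); rewrite ?k4 //.
- exact: ltnW.
- split; first by rewrite updE h4.
  exists [::]; split=> //; rewrite /rest updE h4 ?drop0 //.
  by case/H.
- move=> j s5 lt _ f5 [h5 [tb' [sz al E1 E2]]].
  have [_ z5 _ n5 _] := base_off f5 isT bs4.
  have np : 0 < n' <= L by rewrite lt0n n'0 ltnW.
  apply: W_spec (@W_read_table b n' (nth [::] tb j) (encI (drop j.+1 tb)) s5 z5 n5 np h5 _) _.
    move=> hb; have [v wE' _ _] := H hb; rewrite (k'E hb) in lt.
    have [t Et tok] := encI_row v lt; rewrite (n'E hb); split=> //.
    by rewrite E2 // (drop_nth [::]) //; case: v => _ _ ->.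
  move=> s6 [h6 [ys [yok E3 E4]]] _; split=> //.
  exists (rcons tb' ys); split=> //.
  + by rewrite size_rcons sz.
  + by rewrite all_rcons yok.
  + rewrite /encI map_rcons -cats1 flatten_cat /= cats0 -catA -/(encI tb').
    by rewrite [LHS]E1 E3.
move=> s5 _ f5 [h5 [tb' [sz al E1 E2]]]; rewrite wifscan scan_rest //.
have bs5 := base_off f5 isT bs4.
case E3: (rest w s5) => [|a tl] /=.
  (* For all runs the tables are those collected by the parse; the successful run aims at the given
     ones. *)
  have [v wE'] : valid k' n' (if b then tb' else tb) /\ w = encI (if b then tb' else tb).
    case: (b) H k'E n'E => [_ _ _|/(_ erefl)[v wE' _ _] k'E n'E].
      by split; [split; rewrite ?lt0n|rewrite [LHS]E1 E3 cats0].
    by rewrite k'E // n'E.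
  rewrite wskip; exists k', n', (if b then tb' else tb); split=> //.
  - by split; apply: ltnW.
  - by move=> hb; split; [exact: k'E|exact: n'E|rewrite hb].
rewrite wfail; case: (b) E2 H k'E => // E2 H k'E.
have [[_ _ szt _] _ _ _] := H erefl.
by move: (E2 erefl); rewrite E3 (k'E erefl) -szt drop_size.
Qed.

End Parse.

Lemma valid_size k n tb : valid k n tb -> k <= size (encI tb) /\ n <= size (encI tb).
Proof.
case=> k0 n0 sz al; split.
  by rewrite -sz; apply: size_flatten_ge => ys; rewrite size_rcons.
case: tb sz al => [|ys tb] /=; first by move=> E; rewrite -E in k0.
move=> _ /andP[/andP[/eqP szy _] _]; rewrite size_cat size_rcons.
have := size_flatten_ge ys size_encP.
by rewrite szy; lia.
Qed.

(** Soundness and completeness in one statement: with [b = true] any run that passes proves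
    [good w], with [b = false] the assumption [good w] yields such a run. *)
Lemma W_main b w : (b = false -> good w) -> W w b main_cmd (fun _ => good w) (init w).
Proof.
move=> H; rewrite /main_cmd wseq winc wseq; set s1 := upd _ _ _.
have [k [n [tb G]]] : exists k n tb, b = false -> [/\ valid k n tb, w = encI tb &
    forall u, u \in tuples 4 n -> nth 0 u 2 != nth 0 u 3 -> ~~ bad k n tb u].
  case: (b) H => [_|/(_ erefl)[k [n [tb G]]]]; first by exists 0, 0, [::].
  by exists k, n, tb.
apply: W_mono (@W_parse w b k n tb s1 erefl erefl erefl _) => [s2|]; last first.
  move=> /G[v wE _]; split=> //; have := valid_size v; rewrite -wE ltnS => -[] //.
case=> [k' [n' [tb' [v wE bs [kL nL] same]]]].
have G' : b = false -> forall u, u \in tuples 4 n' -> nth 0 u 2 != nth 0 u 3 -> ~~ bad k' n' tb' u.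
  by move=> hb; have [-> -> ->] := same hb; have [_ _] := G hb.
have [_ _ _ n2 _] := bs.
pose I (l : seq (seq nat)) (s0 : store) :=
  forall u, u \in l -> nth 0 u 2 != nth 0 u 3 -> ~~ bad k' n' tb' u.
apply: (@W_nest _ _ _ _ _ _ I); rewrite ?n2 //.
- move=> l u l' s0 E us f0 Il.
  have uV : u \in tuples 4 n' by rewrite E mem_cat inE eqxx orbT.
  have Iu s : (nth 0 u 2 != nth 0 u 3 -> ~~ bad k' n' tb' u) -> I (rcons l u) s.
    by move=> h x; rewrite mem_rcons inE => /orP[/eqP->//|]; apply: Il.
  rewrite wifeq; case: eqP => ne.
    by rewrite wskip; apply: Iu; rewrite -us /= ne eqxx.
  have r0 : ready w k' n' u s0 by split=> //; apply: base_off f0 _ bs.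
  apply: W_mono (W_count v wE kL nL uV r0 _) => [s nb|hb]; first exact: Iu.
  by apply: G' => //; rewrite -us /=; apply/eqP.
- by move=> s _ Is; exists k', n', tb'; split.
Qed.

Lemma NL_good : NL good.
Proof.
apply: (@NL_cmd 41 main_cmd) => // w; first exact: W_main.
by move=> g; apply: W_mono (W_main (b := false) (fun _ => g)).
Qed.

(** * Reachability and complete regularity *)

Lemma count_sub_eq (T : eqType) (p q : pred T) s : (forall x, p x -> q x) ->
  count q s <= count p s -> {in s, forall x, q x -> p x}.
Proof.
move=> pq le x xs qx; apply: contraLR le => npx; rewrite -ltnNge.
have E : count q s = count p s + count (predD q p) s.
  elim: s {xs} => //= y s ->.
  by have := pq y; case: (p y) => [/(_ isT)->|_] /=; case: (q y) => /=; lia.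
rewrite E -[ltnLHS]addn0 ltn_add2l -has_count.
by apply/hasP; exists x => //=; rewrite npx.
Qed.

Section Saturation.
Variables (k n : nat) (tb : seq (seq nat)) (u : seq nat).
Hypotheses (tbP : valid k n tb) (uV : u \in tuples 4 n).
Notation V := (tuples 4 n).
Notation rch := (rch k n tb u).

Definition step_closed d := forall x j, rch d x -> j < k -> rch d (move_all tb j x).

(** As long as the set reached is not closed under the generators, the next distance adds a vertex,
    and there are only n^4 vertices. *)
Lemma rch_saturates : exists2 d, d <= n ^ 4 & step_closed d.
Proof.
suff gen d : (exists2 d', d' <= d & step_closed d') \/ d < count (rch d) V.
  have [//|] := gen (n ^ 4); have := count_size (rch (n ^ 4)) V.
  by rewrite (size_tuples 4); lia.
elim: d => [|d [[d' le cl]|IH]].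
- by right; rewrite -has_count; apply/hasP; exists u => //=.
- by left; exists d' => //; rewrite leqW.
have [le|lt] := leqP (count (rch d.+1) V) (count (rch d) V); last by right; lia.
left; exists d => // x j rx jk; apply: (count_sub_eq _ le).
- by move=> y; apply: rch_leq.
- by apply: (act_all_V tbP) => //; apply: rch_V rx.
- exact: rch_step.
Qed.

Lemma rch_foldl js : all (fun j => j < k) js ->
  rch (n ^ 4) (foldl (fun x j => move_all tb j x) u js).
Proof.
have [d le cl] := rch_saturates => al.
apply: (rch_leq tbP uV le); elim/last_ind: js al => [|js j IH].
  by move=> _; apply: (rch_leq tbP uV (leq0n d)) => /=.
by rewrite all_rcons foldl_rcons => /andP[jk /IH rj]; apply: cl.
Qed.

End Saturation.

(** * Complete regularity through images and powers *)

Section Regular.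
Variable n : nat.
Notation T := (transformation n).
Implicit Types x y : T.
Local Open Scope group_scope.

Lemma trans_mulE x y p : (x * y) p = y (x p).
Proof. by rewrite [LHS]ffunE. Qed.

(** With [y] the inverse of [x] in its group, [x * x * y = x]; hence [y] recovers [x p] from
    [x (x p)]. *)
Lemma regular_inj (S : T -> Prop) x : completely_regular S -> S x ->
  forall p q, x (x p) = x (x q) -> x p = x q.
Proof.
move=> cr /cr[G [_ [_ [e [_ eG inv]]]] Gx] p q E.
have [y [_ xy _]] := inv x Gx; have [_ xe] := eG x Gx.
have back r : y (x (x r)) = x r by rewrite -(trans_mulE x y) xy -trans_mulE xe.
by rewrite -back E back.
Qed.

Section Powers.
Variable x : T.
Hypothesis inj_x : forall p q, x (x p) = x (x q) -> x p = x q.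

(* The power of exponent [m.+1]. *)
Definition pow m : T := iter m (fun y => y * x) x.

Lemma powD i j : pow i * pow j = pow (i + j).+1.
Proof. by elim: j => [|j IH]; rewrite ?addn0 // addnS /= mulgA IH. Qed.

Lemma pow_last m p : exists q, pow m p = x q.
Proof. by case: m => [|m]; [exists p|exists (pow m p); rewrite /= trans_mulE]. Qed.

(** The values of every power lie in the image of [x], where [x] is injective, so a last factor can
    be cancelled. *)
Lemma pow_cancel i j : pow i.+1 = pow j.+1 -> pow i = pow j.
Proof.
move=> E; apply/ffunP => p; have := congr1 (fun y : T => y p) E.
rewrite /= !trans_mulE; have [q ->] := pow_last i p; have [r ->] := pow_last j p.
exact: inj_x.
Qed.

(** By finiteness two powers agree; cancellation then lowers the smaller exponent to 1. *)
Lemma pow_period : exists2 d, 0 < d & pow d = pow 0.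
Proof.
have [i [j [lt E]]] : exists i j, i < j /\ pow i = pow j.
  pose f (i : 'I_#|{: T}|.+1) := pow i.
  have /injectivePn[i [j ij E]] : ~~ injectiveb f.
    by apply/negP => /injectiveP /leq_card; rewrite card_ord ltnn.
  by case: (ltngtP i j) ij => [lt|gt|/val_inj->]; rewrite ?eqxx // => _;
    [exists i, j|exists j, i].
exists (j - i); first by rewrite subn_gt0.
elim: i j lt E => [|i IH] j lt E; first by rewrite subn0.
by case: j lt E => // j lt /pow_cancel/IH; apply.
Qed.

Lemma pow_subgroup : is_subgroup (fun y => exists m, y = pow m).
Proof.
have [[//|d] _ dE] := pow_period.
have per m : pow (m + d.+1) = pow m.
  elim: m => [|m IH]; first by rewrite add0n.
  by rewrite addSn /= IH.
have perM c m : pow (m + c * d.+1) = pow m.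
  elim: c => [|c IH]; first by rewrite addn0.
  by rewrite mulSn addnCA addnC per.
have ed m : pow d * pow m = pow m by rewrite powD addnC -addnS per.
have de m : pow m * pow d = pow m by rewrite powD -addnS per.
split=> [_ _ [i ->] [j ->]|]; first by rewrite powD; eexists.
exists (pow d); split=> [|_ [m ->]|_ [m ->]]; [by exists d|by []|].
(* The identity [pow d] has exponent [d.+1], which is a period. The inverse of exponent [m.+1] is
   taken as [(d * m.+2).+1], since the two add up to [m.+2 * d.+1]. *)
have E : (m + d * m.+2).+1 = d + m.+1 * d.+1 by lia.
exists (pow (d * m.+2)); split; first by exists (d * m.+2)%N.
  by rewrite powD E perM.
by rewrite powD [(_ + m)%N]addnC E perM.
Qed.

End Powers.

Lemma inj_regular (A : T -> Prop) :
  (forall x, generated A x -> forall p q, x (x p) = x (x q) -> x p = x q) ->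
  completely_regular (generated A).
Proof.
move=> inj x Sx; exists (fun y => exists m, y = pow x m); last by exists 0.
split; last by apply: pow_subgroup; apply: inj.
move=> _ [m ->]; elim: m => [|m IH] //=; exact: gen_mul.
Qed.

End Regular.

(** * Words over the generators as sequences of table lookups *)

Section Encoding.
Variables (k n : nat) (a : k.-tuple (transformation n)).

Definition tables : seq (seq nat) :=
  [seq [seq val ((b : transformation n) i) | i <- enum 'I_n] | b <- a].

Lemma encode_tables : encode a = encI tables.
Proof.
rewrite /encode /encI /tables -map_comp; congr flatten; apply: eq_map => b /=.
by rewrite /encode_transformation /encT -map_comp.
Qed.

Lemma tables_valid : 0 < k -> 0 < n -> valid k n tables.
Proof.
move=> k0 n0; split=> //; first by rewrite size_map size_tuple.
apply/allP => _ /mapP[b _ ->]; rewrite /table_ok size_map -cardE card_ord eqxx.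
by rewrite all_map; apply/allP => i _ /=.
Qed.

Lemma act_tables j (jk : j < k) (i : 'I_n) :
  act tables j i = tnth a (Ordinal jk) i.
Proof.
rewrite /act (nth_map (tnth a (Ordinal jk))) ?size_tuple //.
rewrite (nth_map i) ?size_enum_ord // nth_ord_enum.
by rewrite -[nth _ a j](tnth_nth _ a (Ordinal jk)).
Qed.

Definition run (i : nat) (js : seq nat) : nat := foldl (fun i j => act tables j i) i js.

Lemma run_moves v js : foldl (fun x j => move_all tables j x) v js = map (run^~ js) v.
Proof.
elim: js v => [|j js IH] v /=; first by rewrite map_id.
by rewrite IH /move_all -map_comp.
Qed.

Notation S := (generated (fun b => b \in a)).

Lemma generated_word x : S x -> exists js,
  all (fun j => j < k) js /\ forall i : 'I_n, run i js = x i.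
Proof.
elim=> {x} [x /tnthP[[j jk] xE]|x y _ [js [al1 E1]] _ [js' [al2 E2]]].
  by exists [:: j]; rewrite /= jk; split=> // i; rewrite /run /= act_tables -xE.
exists (js ++ js'); rewrite all_cat al1 al2; split=> // i.
by rewrite trans_mulE /run foldl_cat -/(run _ js) E1 -/(run _ js') E2.
Qed.

(** The word is nonempty because a semigroup need not contain the identity map. *)
Lemma word_generated j js : all (fun j => j < k) (j :: js) ->
  exists2 x, S x & forall i : 'I_n, run i (j :: js) = x i.
Proof.
elim/last_ind: js => [|js j' IH].
  rewrite /= andbT => jk; exists (tnth a (Ordinal jk)); first exact/gen_in/mem_tnth.
  by move=> i; rewrite /run /= act_tables.
rewrite -rcons_cons all_rcons => /andP[jk /IH[x Sx xE]].
exists (mul x (tnth a (Ordinal jk))) => [|i]; first by apply: gen_mul => //; exact/gen_in/mem_tnth.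
by rewrite trans_mulE /run foldl_rcons -/(run i (j :: js)) xE act_tables.
Qed.

Lemma bad_regular : 0 < k -> 0 < n ->
  completely_regular S <->
  forall u, u \in tuples 4 n -> nth 0 u 2 != nth 0 u 3 -> ~~ bad k n tables u.
Proof.
move=> k0 n0; have tbP := tables_valid k0 n0; split=> [cr u uV ne|nbad].
  apply/negP => /hasP[v vV /andP[/rch_word[js [_ al vE]]]].
  move: uV ne vE; rewrite mem_tuples; case: u => [|p [|q [|r [|s [|]]]]] //=.
  case/and5P=> pn qn rn sn _ ne; rewrite run_moves => <- /= /eqP[pr qs rs].
  (* The empty word moves nothing, so it would force [r = s]. *)
  case: js al pr qs rs => [|j js] al pr qs rs; first by move: ne; rewrite /run /= in rs; rewrite rs eqxx.
  have [x Sx xE] := word_generated al.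
  pose o i (lt : i < n) : 'I_n := Ordinal lt.
  have xp : x (o p pn) = o r rn by apply: val_inj; rewrite /= -pr -xE.
  have xq : x (o q qn) = o s sn by apply: val_inj; rewrite /= -qs -xE.
  have := regular_inj cr Sx (p := o p pn) (q := o q qn); rewrite xp xq => E.
  have rs' : x (o r rn) = x (o s sn) by apply: val_inj; rewrite /= -!xE.
  by have /(congr1 val) /= rsE := E rs'; rewrite rsE eqxx in ne.
apply: inj_regular => x Sx p q E; apply/eqP/negPn/negP => ne.
pose u : seq nat := [:: val p; val q; val (x p); val (x q)].
have uV : u \in tuples 4 n by rewrite mem_tuples /= !ltn_ord.
have /negP := nbad u uV ne; apply; apply/hasP.
have [js [al xE]] := generated_word Sx.
have rv := rch_foldl tbP uV al.
exists (foldl (fun x j => move_all tables j x) u js); first exact: rch_V rv.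
by rewrite rv run_moves /= !xE E eqxx.
Qed.

End Encoding.

Lemma valid_tables k n tb : valid k n tb ->
  exists a : k.-tuple (transformation n), tb = tables a.
Proof.
case=> k0 + sz; case: n => // n _ al.
(* All entries are below [n.+1], so [inord] never falls back to its default. *)
pose f ys : transformation n.+1 := [ffun i : 'I_n.+1 => inord (nth 0 ys i)].
have szf : size (map f tb) == k by rewrite size_map sz.
exists (Tuple szf); rewrite /tables /= -map_comp -[LHS]map_id.
apply/eq_in_map => ys /(allP al)/andP[/eqP szy aly] /=.
apply: (@eq_from_nth _ 0) => [|i lt]; first by rewrite size_map -cardE card_ord.
rewrite szy in lt.
rewrite (nth_map ord0) ?size_enum_ord // ffunE /= nth_enum_ord // inordK //.
by apply: (allP aly); apply: mem_nth; rewrite szy.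
Qed.

Lemma good_regular w : good w <-> CompletelyRegular w.
Proof.
split=> [[k [n [tb [v wE nb]]]]|[k [n [a [k0 n0 wE cr]]]]].
  have [a aE] := valid_tables v; have [k0 n0 _ _] := v; exists k, n, a; split=> //.
    by rewrite encode_tables -aE.
  by apply/bad_regular => //; rewrite -aE.
exists k, n, (tables a); split; first exact: tables_valid.
  by rewrite wE encode_tables.
exact/bad_regular.
Qed.

Theorem theorem5p6 : NL CompletelyRegular.
Proof.
have [M [C H]] := NL_good; exists M, C => w; have [h1 h2 h3] := H w; split=> //.
by split=> [/good_regular/h3|/h3/good_regular].
Qed.
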